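(* Let $a,b,c$ be sequences of positive integers (indexed by $N$), and let $\mathcal X_{a\times b\times c}[\mathrm{size}]$ be the size of a uniformly random plane partition fitting in an $a\times b\times c$ box. Then, as $N\to\infty$: (i) $\mathcal X_{a\times b\times c}[\mathrm{size}]^*\Rightarrow\mathcal N(0,1)$ if and only if $\mathrm{median}\{a,b,c\}\to\infty$; (ii) $\mathcal X_{a\times b\times c}[\mathrm{size}]^*\Rightarrow\mathcal{IH}_M^*$ if $ab\to M<\infty$ and $c\to\infty$.
   Context: A plane partition is a finite lower order ideal of $\mathbb Z_{\ge1}^3$ under the componentwise order (a finite stack of unit cubes pushed toward the origin); its size is the number of cubes. $\mathrm{PP}(a\times b\times c)$ is the set of plane partitions contained in $[1,a]\times[1,b]\times[1,c]$, and $\mathcal X_{a\times b\times c}[\mathrm{size}]$ is the size of a uniformly random element. For a random variable $\mathcal X$ with mean $\mu$ and standard deviation $\sigma>0$, $\mathcal X^*=(\mathcal X-\mu)/\sigma$. $\mathcal{IH}_M$ is the Irwin--Hall distribution, the sum of $M$ independent $\mathcal U[0,1]$ random variables. $\Rightarrow$ denotes convergence in distribution. *)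

(* Defs.v *)
From HB Require Import structures.
From mathcomp Require Import all_boot all_order all_algebra finmap.
From mathcomp Require Import all_classical all_reals all_analysis.
From mathcomp Require Import measurable_realfun.

Set Implicit Arguments.
Unset Strict Implicit.
Unset Printing Implicit Defensive.

Import Order.TTheory GRing.Theory Num.Theory.
Import numFieldNormedType.Exports.

Local Open Scope classical_set_scope.
Local Open Scope ring_scope.

(* The sample space: finite sets of unit cubes, a cube being a triple of
   coordinates, with the discrete sigma-algebra. *)
Definition cubes : Type := {fset nat * nat * nat}.
HB.instance Definition _ := Choice.on cubes.

Definition cube_pos (x : nat * nat * nat) : bool :=
  [&& 0 < x.1.1, 0 < x.1.2 & 0 < x.2]%N.

Definition cube_le (x y : nat * nat * nat) : bool :=
  [&& x.1.1 <= y.1.1, x.1.2 <= y.1.2 & x.2 <= y.2]%N.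

Definition plane_partition (p : cubes) : Prop :=
  (forall x, x \in p -> cube_pos x) /\
  (forall x y, y \in p -> cube_pos x -> cube_le x y -> x \in p).

Definition box (a b c : nat) : cubes :=
  [fset x in [seq (ij, k) | ij <- [seq (i, j) | i <- iota 1 a, j <- iota 1 b],
                            k <- iota 1 c]]%fset.

Definition PP (a b c : nat) : {fset cubes} :=
  [fset p in fpowerset (box a b c) | `[< plane_partition p >]]%fset.

Lemma in_box a b c (x : nat * nat * nat) : x \in box a b c =
  [&& (0 < x.1.1 <= a), (0 < x.1.2 <= b) & (0 < x.2 <= c)]%N.
Proof.
rewrite !inE; case: x => [[i j] k]/=.
apply/allpairsP/idP => [[[ij k'] /= [/allpairsP[[i' j'] /= [+ + ->]]]]|].
  by rewrite !mem_iota !add1n !ltnS => + + + [-> -> ->] => -> -> ->.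
case/and3P=> hi hj hk; exists ((i, j), k); split=> //=.
  apply/allpairsP; exists (i, j); split=> //=.
    by rewrite mem_iota add1n ltnS.
  by rewrite mem_iota add1n ltnS.
by rewrite mem_iota add1n ltnS.
Qed.

Lemma in_PP a b c (p : cubes) : p \in PP a b c <->
  plane_partition p /\
  (forall x, x \in p -> x \in box a b c).
Proof.
rewrite /PP !inE fpowersetE; split.
  by case/andP => /fsubsetP pb /asboolP.
by case=> /asboolP -> pb; rewrite andbT; apply/fsubsetP.
Qed.

Lemma fset0_in_PP a b c : (fset0 : cubes) \in PP a b c.
Proof. by apply/in_PP; split=> [|x]; [split=> [x|x y]|]; rewrite inE. Qed.

Lemma card_PP_gt0 a b c : (0 < #|` PP a b c|)%N.
Proof. by rewrite cardfs_gt0; apply/fset0Pn; exists fset0; exact: fset0_in_PP. Qed.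

HB.instance Definition _ := isPointed.Build cubes fset0.
HB.instance Definition _ := @isMeasurable.Build default_measure_display cubes
  discrete_measurable discrete_measurable0
  discrete_measurableC discrete_measurableU.

Section uniform_PP.
Context {R : realType} (a b c : nat).

Definition uniform_PP (A : set cubes) : \bar R :=
  (#|` [fset p in PP a b c | p \in A]%fset|%:R / #|` PP a b c|%:R)%:E.

Let n := #|` PP a b c|.
Let w : {nonneg R} := ((n%:R : R)^-1)%:nng.
Let m : {measure set cubes -> \bar R} :=
  mscale w (msum (fun k => @dirac _ cubes (nth fset0 (PP a b c) k) R) n).

Let uniform_PPE : uniform_PP = m.
Proof.
apply/funext => A; rewrite /uniform_PP /m /mscale /msum/= mulrC EFinM.
congr (_ * _)%E; pose D (p : cubes) := @dirac _ cubes p R A.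
transitivity (\sum_(k < n) D (nth (fset0 : cubes) (PP a b c) k))%E => //.
rewrite /n -(big_mkord xpredT (fun k => D (nth (fset0 : cubes) (PP a b c) k))).
rewrite -(big_nth (fset0 : cubes) xpredT D) /D.
under eq_bigr do rewrite diracE.
rewrite sumEFin -natr_sum -big_mkcond/= sum1_count; congr (_ %:R%:E).
rewrite -size_filter; apply/perm_size/uniq_perm.
- exact: fset_uniq.
- by rewrite filter_uniq// fset_uniq.
- by move=> p; rewrite mem_filter !inE/= andbC.
Qed.

Let uniform_PP0 : uniform_PP set0 = 0%E.
Proof. by rewrite uniform_PPE measure0. Qed.

Let uniform_PP_ge0 A : (0 <= uniform_PP A)%E.
Proof. by rewrite uniform_PPE measure_ge0. Qed.

Let uniform_PP_sigma_additive : semi_sigma_additive uniform_PP.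
Proof. rewrite uniform_PPE; exact: measure_semi_sigma_additive. Qed.

HB.instance Definition _ := isMeasure.Build _ _ _ uniform_PP
  uniform_PP0 uniform_PP_ge0 uniform_PP_sigma_additive.

Let uniform_PP_setT : uniform_PP [set: cubes] = 1%:E.
Proof.
rewrite /uniform_PP; congr (_%:E).
rewrite (_ : [fset p in PP a b c | p \in _]%fset = PP a b c).
  by rewrite divff// pnatr_eq0 -lt0n card_PP_gt0.
by apply/fsetP => p; rewrite !inE/= in_setT andbT.
Qed.

HB.instance Definition _ := Measure_isProbability.Build _ _ _
  uniform_PP uniform_PP_setT.

Definition pp_size (p : cubes) : R := #|` p|%:R.

Let measurable_pp_size : measurable_fun [set: cubes] pp_size.
Proof. by []. Qed.

HB.instance Definition _ := isMeasurableFun.Build _ _ _ _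
  pp_size measurable_pp_size.

Definition size_rv : {RV uniform_PP >-> R} := pp_size.

End uniform_PP.

Section standardize.
Context d (T : measurableType d) (R : realType) (P : probability T R).
Variable X : {RV P >-> R}.

Definition standardize_fun (t : T) : R :=
  (X t - fine 'E_P[X]) / Num.sqrt (fine 'V_P[X]).

Let measurable_standardize_fun : measurable_fun [set: T] standardize_fun.
Proof.
by apply: measurable_funM => //; apply: measurable_funB.
Qed.

HB.instance Definition _ := isMeasurableFun.Build _ _ _ _
  standardize_fun measurable_standardize_fun.

Definition standardize : {RV P >-> R} := standardize_fun.

End standardize.

(* The [X n] and [Y] may live on different probability spaces. *)
Definition cvg_in_distribution (R : realType) (d : nat -> measure_display)
    (T : forall n, measurableType (d n)) (P : forall n, probability (T n) R)
    (X : forall n, {RV (P n) >-> R})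
    (d' : measure_display) (T' : measurableType d') (Q : probability T' R)
    (Y : {RV Q >-> R}) : Prop :=
  forall x : R, {for x, continuous (cdf Y)} ->
    cdf (X n) x @[n --> \oo] --> cdf Y x.

Section std_normal.
Context (R : realType).

Definition idR : measurableTypeR R -> R := idfun.

HB.instance Definition _ := isMeasurableFun.Build _ _ _ _ idR
  (@measurable_id _ (measurableTypeR R) setT).

Definition std_normal_rv : {RV (normal_prob (0 : R) 1) >-> R} := idR.

End std_normal.

Section power_probability.
Context d (T : measurableType d) (R : realType) (P : probability T R).

Definition cons_tuple n (xt : T * n.-tuple T) : n.+1.-tuple T :=
  [tuple of xt.1 :: xt.2].

Let measurable_cons_tuple n : measurable_fun [set: T * n.-tuple T] (@cons_tuple n).
Proof. exact: measurable_cons. Qed.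

HB.instance Definition _ n := isMeasurableFun.Build _ _ _ _
  (@cons_tuple n) (@measurable_cons_tuple n).

Fixpoint power_prob n : probability (n.-tuple T) R :=
  match n with
  | 0 => dirac [tuple]
  | n'.+1 => distribution (P \x power_prob n')%E (@cons_tuple n')
  end.

(* The coordinates are independent with law [P]. *)
Lemma power_probE n (A : 'I_n -> set T) : (forall i, measurable (A i)) ->
  power_prob n [set t | forall i, A i (tnth t i)] = (\prod_(i < n) P (A i))%E.
Proof.
elim: n A => [|n IH] A mA.
  by rewrite big_ord0 /= diracE mem_set// => -[].
rewrite big_ord_recl -IH//= /distribution /pushforward/=.
rewrite -product_measure1E//; last first.
  have -> : [set t : n.-tuple T | forall i, A (lift ord0 i) (tnth t i)] =
            \big[setI/setT]_(i < n) ((@tnth n T)^~ i @^-1` A (lift ord0 i)).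
    rewrite -bigcap_seq; apply/seteqP; split => [t /= h i _|t h i] /=; first exact: h.
    by apply: (h i) => /=; rewrite mem_index_enum.
  apply: bigsetI_measurable => i _.
  by rewrite -[X in measurable X]setTI; exact: measurable_tnth.
congr product_measure1; apply/seteqP; split => [[x t] /= h|[x t] /= [h0 h] i].
  split; first by have := h ord0.
  by move=> i; have := h (lift ord0 i); rewrite tnthS.
by case: (unliftP ord0 i) => [j|] ->; [rewrite tnthS; exact: h|].
Qed.

End power_probability.

Section irwin_hall.
Context (R : realType) (M : nat).

Definition uniform01_power : probability (M.-tuple (measurableTypeR R)) R :=
  power_prob (uniform_prob (@ltr01 R)) M.

Definition tuple_sum (t : M.-tuple (measurableTypeR R)) : R :=
  \sum_(i < M) tnth t i.

Let measurable_tuple_sum :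
  measurable_fun [set: M.-tuple (measurableTypeR R)] tuple_sum.
Proof.
by apply: measurable_sum => i; exact: measurable_tnth.
Qed.

HB.instance Definition _ := isMeasurableFun.Build _ _ _ _
  tuple_sum measurable_tuple_sum.

Definition irwin_hall_rv : {RV uniform01_power >-> R} := tuple_sum.

End irwin_hall.

Definition median3 (a b c : nat) : nat := nth 0%N (sort leq [:: a; b; c]) 1.

(* Main.v *)
(** Read the heights of a boxed plane partition along the diagonals: the rows
    interlace, and summing over one interlacing row turns a Vandermonde
    determinant into the next one. This proves MacMahon's box formula, hence
    writes the characteristic function of the centred size as a quotient of
    products of factors sin(n s)/(n s) indexed by the cells of the a x b
    rectangle; the mean is abc/2 and the variance is abc(a+b+c)/12.

    Convergence of E cos(tX+u) for all t and u, together with the tightness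
    given by Chebyshev's inequality, yields convergence in distribution. When
    the median of a, b, c tends to infinity, the logarithm of the quotient is
    -t^2/2 up to an error of the order of 1/median. When the median stays
    bounded along a subsequence, the standardized size is bounded from below by
    minus twice the median, so the limit gives mass 0 to a half-line and is not
    normal. When ab = M and c tends to infinity, the denominator tends to 1 and
    the numerator to the characteristic function of the standardized
    Irwin-Hall law. *)
Require Import Defs.
From HB Require Import structures.
From mathcomp Require Import all_boot all_order perm all_algebra finmap.
From mathcomp Require Import all_classical all_reals all_analysis.
From mathcomp Require Import complex ring lra zify measurable_realfun.

Set Implicit Arguments.
Unset Strict Implicit.
Unset Printing Implicit Defensive.

Import Order.TTheory GRing.Theory Num.Theory.
Import numFieldNormedType.Exports.

Local Open Scope classical_set_scope.
Local Open Scope ring_scope.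

(** Cosines with a phase replace complex characteristic functions: the family cos(tX+u) carries real
    and imaginary parts together and is stable under product-to-sum formulas, so convergence passes
    to all polynomials in a sine. Distribution functions are then squeezed between expectations of
    such polynomials, chosen close to a step on a large interval; tightness pays for the rest. The
    quotient of sine products has a denominator that may vanish, so the exact identities keep it as
    a factor. For the normal limit both products are compared with products of Gaussians
    exp(-x^2/6), whose quotient is exactly exp(-t^2/2), and only the Gaussian denominator, which is
    bounded below, is divided out. The comparison costs 1/(ab), which is good enough when c is the
    largest side; the symmetry of the generating function under permutations of the sides reduces
    the general case to this one. *)

(** * Rows interlacing a given row *)

Section interlacing.

(* [interl w y] enumerates the rows [y] with
   [w_0 <= y_0 <= w_1 <= y_1 <= ... <= w_n]. *)
Fixpoint interl (w0 : nat) (w : seq nat) : seq (seq nat) :=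
  if w is w1 :: w' then
    [seq y0 :: y | y0 <- index_iota w0 w1.+1, y <- interl w1 w']
  else [:: [::]].

Lemma size_interl w0 w y : y \in interl w0 w -> size y = size w.
Proof.
elim: w w0 y => [|w1 w IH] w0 y /=; first by rewrite inE => /eqP ->.
by case/allpairsP=> -[y0 y'] [_ /IH /= e ->] /=; rewrite e.
Qed.

Lemma mem_interl w0 w y : (y \in interl w0 w) =
  (size y == size w) && all (fun i => nth 0 (w0 :: w) i <= nth 0 y i <= nth 0 w i)%N
    (iota 0 (size w)).
Proof.
elim: w w0 y => [|w1 w IH] w0 [|y0 y] //=.
- by apply/negP => /allpairsP[[? ?] []].
- transitivity ((y0 \in index_iota w0 w1.+1) && (y \in interl w1 w)).
    apply/allpairsP/andP => [[[z0 z] [/= z0i zi [-> ->]]]|[h1 h2]]; first by split.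
    by exists (y0, y).
  rewrite IH mem_index_iota ltnS eqSS -(addn0 1%N) iotaDl all_map.
  by rewrite -!andbA; do !bool_congr.
Qed.

Lemma interl_uniq w0 w : uniq (interl w0 w).
Proof.
elim: w w0 => [|w1 w IH] w0 //=.
apply: allpairs_uniq => //; first exact: iota_uniq.
by move=> [? ?] [? ?] _ _ /= [-> ->].
Qed.

(** The bounds on the entries come from [w] alone, so the entries range over their intervals
    independently and the sum factors as over a box. *)
Lemma sum_interl (R : comNzRingType) (F : nat -> nat -> R) w0 w :
  \sum_(y <- interl w0 w) \prod_(i < size w) F i (nth 0%N y i) =
  \prod_(i < size w) \sum_(nth 0%N (w0 :: w) i <= k < (nth 0%N w i).+1) F i k.
Proof.
elim: w w0 F => [|w1 w IH] w0 F /=; first by rewrite big_seq1 !big_ord0.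
rewrite big_allpairs_dep big_ord_recl /= -(IH w1 (fun i => F i.+1)) mulr_suml.
apply: eq_bigr => y0 _; rewrite mulr_sumr; apply: eq_bigr => y _.
by rewrite big_ord_recl.
Qed.

End interlacing.

(** * Vandermonde determinants in powers of q, summed over interlacing rows *)

Section vandermonde.
Variables (R : comNzRingType) (q : R).

Definition vdm n (l : nat -> nat) : R :=
  \det (Vandermonde n (\row_(i < n) q ^+ l i)).

Lemma vdmE n l : vdm n l =
  \prod_(i < n) \prod_(j < n | (i < j)%N) (q ^+ l j - q ^+ l i).
Proof.
rewrite /vdm det_Vandermonde; apply: eq_bigr => i _; apply: eq_bigr => j _.
by rewrite !mxE.
Qed.

(* Subtracting from each row of the transposed Vandermonde matrix the previous
   one leaves a single nonzero entry in the column of ones. *)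
Lemma vdm_diff n l : vdm n.+1 l =
  \det (\matrix_(i < n, j < n) ((q ^+ j.+1) ^+ l i.+1 - (q ^+ j.+1) ^+ l i)).
Proof.
pose V := (Vandermonde n.+1 (\row_(i < n.+1) q ^+ l i))^T.
pose L : 'M[R]_n.+1 := \matrix_(i, k) ((k == i)%:R - (k.+1 == i :> nat)%:R).
have dL : \det L = 1.
  rewrite det_trig; last first.
    apply/is_trig_mxP => i j ij; rewrite mxE -val_eqE /= gtn_eqF//.
    by rewrite gtn_eqF ?subr0// ltnS ltnW.
  by apply: big1 => i _; rewrite mxE eqxx gtn_eqF// subr0.
have -> : vdm n.+1 l = \det (L *m V) by rewrite det_mulmx dL mul1r det_tr.
have E i j : (L *m V) i j =
    (q ^+ l i) ^+ j - (if i == 0%N :> nat then 0 else (q ^+ l i.-1) ^+ j).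
  rewrite mxE; under eq_bigr do rewrite !mxE mulrBl.
  rewrite sumrB (bigD1 i)//= eqxx mul1r big1 ?addr0; last first.
    by move=> k /negPf ->; rewrite mul0r.
  congr (_ - _); case: (posnP i) => [->|i0].
    by apply: big1 => k _; rewrite mul0r.
  have hi : (i.-1 < n.+1)%N by have := ltn_ord i; lia.
  rewrite (bigD1 (Ordinal hi))//= prednK// eqxx mul1r big1 ?addr0 => [|k].
    by [].
  rewrite -val_eqE/= => ki; have [e|] := eqVneq k.+1 (i : nat); last by rewrite mul0r.
  by move: ki; rewrite -e eqxx.
rewrite (expand_det_col _ ord0) big_ord_recl big1 ?addr0 => [|i _]; last first.
  by rewrite E/= !expr0 subrr mul0r.
rewrite E/= expr0 subr0 mul1r /cofactor expr0 mul1r.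
congr (\det _); apply/matrixP => i j; rewrite [LHS]mxE [LHS]mxE E !mxE/=.
by rewrite -!exprM ![(_ * j.+1)%N]mulnC.
Qed.

Lemma geometric_sum (x : R) m n : (m <= n)%N ->
  (x - 1) * \sum_(m <= k < n) x ^+ k = x ^+ n - x ^+ m.
Proof.
move=> mn; rewrite mulr_sumr -(telescope_sumr _ mn).
by apply: eq_bigr => k _; rewrite mulrBl mul1r exprS.
Qed.

(** The powers of q raise the column exponents from j to j+1. By multilinearity the sum over [y]
    then acts row by row: the shift by i makes y_i + i range over the half-open interval from l_i to
    l_{i+1}, and the factor q^(j+1) - 1 closes the resulting geometric sum into the differences of
    [vdm_diff]. *)
Lemma vdm_interl w0 w : sorted leq (w0 :: w) ->
  (\sum_(y <- interl w0 w) q ^+ (sumn y) * vdm (size w) (fun i => nth 0%N y i + i)%N) *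
    (\prod_(j < size w) q ^+ j) * (\prod_(j < size w) (q ^+ j.+1 - 1)) =
  vdm (size w).+1 (fun i => nth 0%N (w0 :: w) i + i)%N.
Proof.
move=> sw; set n := size w; set l := (fun i => nth 0%N (w0 :: w) i + i)%N.
have ->: (\sum_(y <- interl w0 w) q ^+ (sumn y) * vdm n (fun i => nth 0%N y i + i)%N) *
   \prod_(j < n) q ^+ j =
   \sum_(y <- interl w0 w) \det (\matrix_(i < n, j < n) (q ^+ j.+1) ^+ (nth 0%N y i + i)).
  rewrite mulr_suml; apply: eq_big_seq => y /size_interl sy.
  rewrite mulrAC.
  have -> : q ^+ sumn y * \prod_(j < n) q ^+ j = \prod_(i < n) q ^+ (nth 0%N y i + i).
    rewrite sumnE (big_nth 0%N) sy big_mkord.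
    by under [RHS]eq_bigr do rewrite exprD; rewrite big_split/= -prodrXr.
  rewrite /vdm -det_tr -[X in X * _](_ : \det (diag_mx (\row_(i < n) q ^+ (nth 0%N y i + i))) = _).
    rewrite -det_mulmx; congr (\det _); apply/matrixP => i j.
    by rewrite mul_diag_mx !mxE/= -exprS -!exprM mulnC.
  by rewrite det_diag; apply: eq_bigr => i _; rewrite mxE.
have -> : \sum_(y <- interl w0 w)
      \det (\matrix_(i < n, j < n) (q ^+ j.+1) ^+ (nth 0%N y i + i)) =
    \det (\matrix_(i < n, j < n) \sum_(l i <= k < l i.+1) (q ^+ j.+1) ^+ k).
  rewrite /determinant exchange_big/=; apply: eq_bigr => s _.
  rewrite -mulr_sumr; congr (_ * _).
  (* [sum_interl] takes a function on [nat]; [insub] extends the permutation [s] by a default that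
     is never read. *)
  pose F i k := (q ^+ (if (insub i : option 'I_n) is Some i' then s i' else 0%N).+1) ^+ (k + i).
  transitivity (\sum_(y <- interl w0 w) \prod_(i < n) F i (nth 0%N y i)).
    by apply: eq_bigr => y _; apply: eq_bigr => i _; rewrite mxE /F valK.
  rewrite sum_interl; apply: eq_bigr => i _; rewrite mxE /l /F/= valK addnS -addSn.
  by rewrite [RHS]big_addn addnK.
rewrite -det_tr mulrC -[X in X * _](_ : \det (diag_mx (\row_(j < n) (q ^+ j.+1 - 1))) = _).
  rewrite -det_mulmx -det_tr vdm_diff; congr (\det _); apply/matrixP => i j.
  rewrite mxE mul_diag_mx !mxE geometric_sum// /l/= addnS leqW// leq_add2r.
  have := sortedP 0%N sw.
  by rewrite /n => /(_ i); apply; rewrite /= ltnS.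
by rewrite det_diag; apply: eq_bigr => i _; rewrite mxE.
Qed.

End vandermonde.

(** * Weighted sums over Gelfand-Tsetlin patterns *)

Section gt_patterns.

(* Gelfand-Tsetlin patterns below the row [w], of size [n.+1]. *)
Fixpoint gt n (w : seq nat) : seq (seq (seq nat)) :=
  if n is n'.+1 then
    [seq y :: g | y <- interl (head 0%N w) (behead w), g <- gt n' y]
  else [:: [::]].

Lemma gt_uniq n w : uniq (gt n w).
Proof.
elim: n w => [|n IH] w //=; apply: allpairs_uniq_dep => //.
  exact: interl_uniq.
by move=> [? ?] [? ?] _ _ /= [-> ->].
Qed.

Lemma mem_gt n w g : size w = n.+1 ->
  g \in gt n w <-> size g = n /\
    (forall k, (k < n)%N -> size (nth [::] g k) = (n - k)%N /\
      forall i, (i < n - k)%N ->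
        (nth 0 (nth [::] (w :: g) k) i <= nth 0 (nth [::] g k) i
           <= nth 0 (nth [::] (w :: g) k) i.+1)%N).
Proof.
elim: n w g => [|n IH] w g sw.
  by rewrite inE; split => [/eqP -> //|[/size0nil -> _]].
case: w sw => // w0 w [sw] /=; split.
  case/allpairsPdep=> y [g' [/=]]; rewrite mem_interl sw => /andP[/eqP sy /allP yP].
  move=> /IH - /(_ sy)[sg' gP] -> /=; split; first by rewrite sg'.
  case=> [_|k kn]; last exact: gP.
  rewrite subn0/=; split => // i; rewrite ltnS => ilt.
  by apply: yP; rewrite mem_iota.
case: g => [[]//|y g] [/= [sg] gP]; apply/allpairsPdep; exists y, g.
have [/= sy yP] := gP 0%N isT; split => //=.
  rewrite mem_interl sw sy subn0 eqxx andTb; apply/allP => i; rewrite mem_iota => /andP[_ ilt].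
  exact: yP.
apply/IH => //; split => // k kn; exact: (gP k.+1).
Qed.

Lemma sorted_interl w0 w y : sorted leq (w0 :: w) -> y \in interl w0 w -> sorted leq y.
Proof.
move=> sw; rewrite mem_interl => /andP[/eqP sy /allP yP].
apply/(sortedP 0%N) => i isy.
have /andP[_ h1] := yP i ltac:(by rewrite mem_iota/= -sy ltnW).
have /andP[h2 _] := yP i.+1 ltac:(by rewrite mem_iota/= -sy).
exact: leq_trans h1 h2.
Qed.

Variables (R : comNzRingType) (q : R).

Definition gt_sum n w : R := \sum_(g <- gt n w) q ^+ sumn (map sumn g).

Lemma gt_sumS n w : gt_sum n.+1 w =
  \sum_(y <- interl (head 0%N w) (behead w)) q ^+ sumn y * gt_sum n y.
Proof.
rewrite /gt_sum/= big_allpairs_dep; apply: eq_bigr => y _.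
by rewrite mulr_sumr; apply: eq_bigr => g _; rewrite -exprD.
Qed.

(** What matters is that [C] does not depend on [w]: its value is read off later from the zero row,
    which has a single pattern. *)
Lemma gt_sum_vdm_ex n : exists C : R, forall w, size w = n.+1 -> sorted leq w ->
  gt_sum n w * C = vdm q n.+1 (fun i => nth 0%N w i + i)%N.
Proof.
elim: n => [|n [C IH]].
  exists 1 => w _ _; rewrite /gt_sum/= big_seq1 mul1r.
  by rewrite vdmE big_ord1 big_pred0 => [|j]; rewrite ?ord1.
exists (C * (\prod_(j < n.+1) q ^+ j) * (\prod_(j < n.+1) (q ^+ j.+1 - 1))) => -[//|w0 w [sw] sow].
rewrite -sw -vdm_interl// sw !mulrA; congr (_ * _ * _).
rewrite gt_sumS mulr_suml; apply: eq_big_seq => y yi /=.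
rewrite -mulrA IH//; first by rewrite (size_interl yi).
exact: sorted_interl yi.
Qed.

Lemma gt_sum0 n : gt_sum n (nseq n.+1 0%N) = 1.
Proof.
elim: n => [|n IH]; first by rewrite /gt_sum/= big_seq1.
have interl0 m : interl 0%N (nseq m 0%N) = [:: nseq m 0%N].
  by elim: m => //= m ->.
rewrite gt_sumS (_ : behead _ = nseq n.+1 0%N)// interl0.
by rewrite big_seq1 IH mulr1 sumn_nseq mul0n.
Qed.

(** The principal specialization of a Schur polynomial as a ratio of alternants, with the
    denominator kept on the left. *)
Lemma gt_sum_vdm n w : size w = n.+1 -> sorted leq w ->
  gt_sum n w * vdm q n.+1 id = vdm q n.+1 (fun i => nth 0%N w i + i)%N.
Proof.
move=> sw sow; have [C CP] := gt_sum_vdm_ex n.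
rewrite -(CP _ sw sow); congr (_ * _).
have := CP (nseq n.+1 0%N); rewrite size_nseq gt_sum0 mul1r => -> //.
  by rewrite !vdmE; apply: eq_bigr => i _; apply: eq_bigr => j _; rewrite !nth_nseq !if_same.
by apply/(sortedP 0%N) => i _; rewrite !nth_nseq !if_same.
Qed.

End gt_patterns.

(** * Plane partitions in a box as Gelfand-Tsetlin patterns with a fixed top row *)

Section heights.
Local Open Scope nat_scope.

(** A column of a plane partition is an initial segment, so membership in it can be recovered from
    its height. *)
Lemma count_downclosed (P : pred nat) c :
    (forall k l, (0 < k <= l)%N -> P l -> P k) ->
  forall k, (0 < k <= c)%N -> P k = (k <= count P (iota 1 c))%N.
Proof.
move=> dP; elim: c => [|c IH] k; first by case: k.
rewrite -[c.+1]addn1 iotaD count_cat/= add1n addn0 => /andP[k0 kc].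
have cc : (count P (iota 1 c) <= c)%N by rewrite -[X in (_ <= X)%N](size_iota 1 c) count_size.
have [PSc|nPSc] := boolP (P c.+1).
  have -> : P k by apply: dP PSc; lia.
  suff -> : count P (iota 1 c) = c by lia.
  rewrite -[RHS](size_iota 1 c); apply/eqP; rewrite -all_count; apply/allP => j.
  by rewrite mem_iota => /andP[j0 jc]; apply: dP PSc; lia.
rewrite addn0; have [kc'|kc'] := leqP k c; first by rewrite IH// k0.
have -> : k = c.+1 by lia.
by rewrite (negbTE nPSc); lia.
Qed.

Variables a b c : nat.

(* The value [c] at [j = 0] makes the column heights of a plane partition,
   read along diagonals, a full Gelfand-Tsetlin pattern. *)
Definition height (p : cubes) i j : nat :=
  if j == 0%N then c else count (fun k => (i, j, k) \in p) (iota 1 c).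

Lemma height_le p i j : (height p i j <= c)%N.
Proof.
rewrite /height; case: ifP => // _.
by rewrite -[X in (_ <= X)%N](size_iota 1 c) count_size.
Qed.

Section fixed_pp.
Variable p : cubes.
Hypothesis pP : p \in PP a b c.

Lemma PP_sub x : x \in p -> [&& 0 < x.1.1 <= a, 0 < x.1.2 <= b & 0 < x.2 <= c]%N.
Proof. by move/in_PP : pP => [_ h] /h; rewrite in_box. Qed.

Lemma mem_height i j k : (0 < i)%N -> (0 < j)%N -> (0 < k <= c)%N ->
  ((i, j, k) \in p) = (k <= height p i j)%N.
Proof.
move=> i0 j0 kc; rewrite /height gtn_eqF//.
apply: (@count_downclosed (fun k => (i, j, k) \in p)) kc => {}k l /andP[k0 kl] lp.
move/in_PP : pP => [[_ dn] _]; apply: (dn _ _ lp); first by rewrite /cube_pos i0 j0.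
by rewrite /cube_le/= !leqnn.
Qed.

Lemma height_gt i j : (a < i)%N -> (0 < j)%N -> height p i j = 0%N.
Proof.
move=> ai j0; rewrite /height gtn_eqF//; apply/eqP; rewrite -leqn0 leqNgt -has_count.
by apply/hasPn => k _; apply/negP => /PP_sub /=; lia.
Qed.

Lemma height_anti i j i' j' : (0 < i <= i')%N -> (j <= j')%N ->
  (height p i' j' <= height p i j)%N.
Proof.
move=> /andP[i0 ii'] jj'; case: (posnP j) => [->|j0]; first exact: height_le.
rewrite /height !gtn_eqF//; last exact: leq_trans jj'.
apply: sub_count => k kp; have := PP_sub kp; rewrite /= => /and3P[_ _ /andP[k0 _]].
move/in_PP : pP => [[_ dn] _]; apply: (dn _ _ kp); first by rewrite /cube_pos i0 j0.
by rewrite /cube_le/= ii' jj' /=.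
Qed.

Lemma card_heights :
  #|` p| = (\sum_(1 <= i < a.+1) \sum_(1 <= j < b.+1) height p i j)%N.
Proof.
pose L := [seq (ij, k) | ij <- [seq (i, j) | i <- iota 1 a, j <- iota 1 b],
                            k <- iota 1 c].
have uL : uniq L.
  by apply: allpairs_uniq; rewrite ?iota_uniq//; [
    apply: allpairs_uniq; rewrite ?iota_uniq// => -[? ?] [? ?] _ _ [-> ->]
   |move=> [? ?] [? ?] _ _ [-> ->]].
have -> : #|` p| = count (mem p) L.
  rewrite -size_filter; apply: perm_size; apply: uniq_perm; rewrite ?filter_uniq//.
  move=> x; rewrite mem_filter /=; case: (boolP (x \in p)) => //= /PP_sub.
  by rewrite -in_box /box !inE => ->.
rewrite -sum1_count /L big_mkcond big_allpairs_dep big_allpairs_dep.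
rewrite /index_iota !subSS !subn0; apply: eq_bigr => i _.
rewrite big_seq [RHS]big_seq; apply: eq_bigr => j; rewrite mem_iota => /andP[j0 _].
by rewrite /height gtn_eqF// -sum1_count [RHS]big_mkcond; apply: eq_bigr.
Qed.

End fixed_pp.

(** Row [k] follows the diagonal x - y = a - k towards decreasing coordinates. Cells with x > a give
    0; from index [b] on, the truncated [b - i] is 0 and [height] returns [c]. This padding gives
    every row the full length a + b - k. *)
Definition pp_row p k := mkseq (fun i => height p (a + b - k - i) (b - i)) (a + b - k).
Definition pp_gt p := mkseq (fun k => pp_row p k.+1) (a + b).-1.
Definition top_row := mkseq (fun i => if (i < b)%N then 0%N else c) (a + b).

Hypotheses (a0 : (0 < a)%N) (b0 : (0 < b)%N).

Lemma pp_row0 p : p \in PP a b c -> pp_row p 0 = top_row.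
Proof.
move=> pP; rewrite /pp_row /top_row subn0; apply: (@eq_from_nth _ 0%N).
  by rewrite !size_mkseq.
rewrite size_mkseq => i iab; rewrite !nth_mkseq//.
case: ltnP => ib; first by rewrite height_gt//; lia.
by rewrite /height (_ : (b - i)%N = 0%N)//; lia.
Qed.

Lemma nth_pp_gt p k : p \in PP a b c -> (k < a + b)%N ->
  nth [::] (top_row :: pp_gt p) k = pp_row p k.
Proof.
case: k => [pP _|k pP kab] /=; first by rewrite pp_row0.
by rewrite nth_mkseq//; lia.
Qed.

Lemma nth_pp_row p k i : (i < a + b - k)%N ->
  nth 0%N (pp_row p k) i = height p (a + b - k - i) (b - i).
Proof. by move=> h; rewrite nth_mkseq. Qed.

Lemma pp_gt_in p : p \in PP a b c -> pp_gt p \in gt (a + b).-1 top_row.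
Proof.
move=> pP; apply/mem_gt; first by rewrite size_mkseq; lia.
split; first by rewrite size_mkseq.
move=> k kn; rewrite nth_mkseq//; split; first by rewrite size_mkseq; lia.
move=> i ink; rewrite nth_pp_gt//; last lia.
rewrite !nth_pp_row; try lia.
by apply/andP; split; apply: height_anti => //; lia.
Qed.

Lemma pp_gt_inj : {in PP a b c &, injective pp_gt}.
Proof.
move=> p p' pP p'P e; apply/fsetP => -[[i j] k].
have [|nb] := boolP [&& 0 < i <= a, 0 < j <= b & 0 < k <= c]%N; last first.
  by apply/idP/idP => /PP_sub; rewrite ?pP ?p'P => /(_ isT)/=; rewrite (negbTE nb).
move=> /and3P[/andP[i0 ia] /andP[j0 jb] kc]; rewrite !mem_height//; congr (_ <= _)%N.
(* The cell (i, j) lies in row a + j - i, at index b - j. *)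
have : nth 0%N (nth [::] (top_row :: pp_gt p) (a + j - i)) (b - j) =
       nth 0%N (nth [::] (top_row :: pp_gt p') (a + j - i)) (b - j) by rewrite e.
rewrite !nth_pp_gt//; try lia; rewrite !nth_pp_row; try lia.
have -> : (a + b - (a + j - i) - (b - j) = i)%N by lia.
by rewrite subKn.
Qed.

Section inverse.
Variable g : seq (seq nat).
Hypothesis gP : g \in gt (a + b).-1 top_row.

(* Entries of the pattern in the coordinates for which rows are antidiagonals. *)
Let G x y := nth 0%N (nth [::] (top_row :: g) ((a + b).-1 - x - y)) x.

Let G_step x y : (x + y < (a + b).-1)%N -> (G x y.+1 <= G x y <= G x.+1 y)%N.
Proof.
move=> xy; have /mem_gt[|sg h] := gP; first by rewrite size_mkseq; lia.
have [_ h2] := h ((a + b).-1 - x - y).-1 ltac:(lia).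
have := h2 x ltac:(lia); rewrite /G.
rewrite (_ : ((a + b).-1 - x - y.+1 = ((a + b).-1 - x - y).-1)%N); last lia.
rewrite (_ : ((a + b).-1 - x.+1 - y = ((a + b).-1 - x - y).-1)%N); last lia.
have : 0 < (a + b).-1 - x - y by lia.
by case: ((a + b).-1 - x - y).
Qed.

Let G_antiy x y d : (x + y + d <= (a + b).-1)%N -> (G x (y + d) <= G x y)%N.
Proof.
elim: d => [|d IH] h; first by rewrite addn0.
apply: leq_trans (IH _); last lia.
by rewrite addnS; have /andP[] := @G_step x (y + d) ltac:(lia).
Qed.

Let G_monox x y d : (x + y + d <= (a + b).-1)%N -> (G x y <= G (x + d) y)%N.
Proof.
elim: d => [|d IH] h; first by rewrite addn0.
apply: leq_trans (IH _) _; first lia.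
by rewrite addnS; have /andP[] := @G_step (x + d) y ltac:(lia).
Qed.

Let G_top x y : (x + y = (a + b).-1)%N -> G x y = if (x < b)%N then 0%N else c.
Proof. by move=> xy; rewrite /G (_ : (_ - y = 0)%N) ?nth_mkseq//; lia. Qed.

Let G_le x y : (x + y <= (a + b).-1)%N -> (G x y <= c)%N.
Proof.
move=> xy; apply: leq_trans (G_monox (d := (a + b).-1 - x - y) _) _; first lia.
by rewrite G_top; [case: ifP|lia].
Qed.

(** Here and in [G_up], interlacing propagates the extreme values of the top row downwards: it
    forces [c] for x >= b and 0 for y >= a, exactly the padding of [pp_row]. *)
Let G_right x y : (x + y <= (a + b).-1)%N -> (b <= x)%N -> G x y = c.
Proof.
move=> xy bx; apply/eqP; rewrite eqn_leq G_le//=.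
apply: leq_trans (G_antiy (d := (a + b).-1 - x - y) _); last lia.
by rewrite G_top ?ltnNge ?bx//; lia.
Qed.

Let G_up x y : (x + y <= (a + b).-1)%N -> (a <= y)%N -> G x y = 0%N.
Proof.
move=> xy ay; apply/eqP; rewrite -leqn0.
apply: leq_trans (G_monox (d := (a + b).-1 - x - y) _) _; first lia.
by rewrite G_top; [rewrite ifT//; lia|lia].
Qed.

Lemma pp_gt_onto : exists2 p, p \in PP a b c & pp_gt p = g.
Proof.
(* The column over (i, j) gets the height [G (b - j) i.-1], which inverts the coordinates of
   [pp_row]. *)
pose p : cubes := [fset x in box a b c | x.2 <= G (b - x.1.2) x.1.1.-1]%fset%N.
have pE i j k : ((i, j, k) \in p) =
    [&& 0 < i <= a, 0 < j <= b, 0 < k <= c & k <= G (b - j) i.-1]%N.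
  have h := in_box a b c (i, j, k); rewrite !inE in h.
  by rewrite !inE h /= -!andbA.
have pP : p \in PP a b c.
  apply/in_PP; split; last by move=> x; rewrite !inE => /andP[].
  split => [[[i j] k]|[[i j] k] [[i' j'] k']].
    by rewrite pE /cube_pos/= => /and4P[/andP[-> _] /andP[-> _] /andP[-> _] _].
  rewrite !pE /cube_pos /cube_le/= => /and4P[h1 h2 h3 h4] /and3P[i0 j0 k0] /and3P[ii' jj' kk'].
  apply/and4P; split; try lia; apply: leq_trans kk' (leq_trans h4 _).
  have /= := @G_antiy (b - j') i.-1 (i' - i) ltac:(lia).
  rewrite (_ : (i.-1 + (i' - i) = i'.-1)%N); last lia.
  move=> /leq_trans; apply.
  have := @G_monox (b - j') i.-1 (j' - j) ltac:(lia).
  by rewrite (_ : (b - j' + (j' - j) = b - j)%N); last lia.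
exists p => //.
have /mem_gt[|sg h] := gP; first by rewrite size_mkseq; lia.
apply: (@eq_from_nth _ [::]); rewrite size_mkseq ?sg// => k kn.
have [sk _] := h k kn; rewrite nth_mkseq//.
apply: (@eq_from_nth _ 0%N); rewrite size_mkseq ?sk; first lia.
move=> i ik; rewrite nth_mkseq//.
have -> : nth 0%N (nth [::] g k) i = G i ((a + b).-1 - k.+1 - i).
  by rewrite /G (_ : ((a + b).-1 - i - _ = k.+1)%N)//; lia.
set y := ((a + b).-1 - k.+1 - i)%N.
have -> : (a + b - k.+1 - i = y.+1)%N by rewrite /y; lia.
rewrite /height; case: eqP => [bi|/eqP]; first by rewrite G_right//; lia.
rewrite -lt0n => bi; have [ya|ya] := ltnP y a; last first.
  rewrite G_up//; last by lia.
  apply/eqP; rewrite -leqn0 leqNgt -has_count; apply/hasPn => l _.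
  by rewrite pE; lia.
rewrite -sum1_count big_mkcond.
have Gc : (G i y <= c)%N by apply: G_le; lia.
rewrite -(subnKC Gc) iotaD big_cat/=.
rewrite [X in (X + _)%N](_ : _ = \sum_(l <- iota 1 (G i y)) 1)%N; last first.
  apply: eq_big_seq => l; rewrite mem_iota => hl; rewrite pE subKn; last lia.
  by rewrite ifT//=; lia.
rewrite sum1_size size_iota big1_seq ?addn0// => l /andP[_]; rewrite mem_iota => hl.
by rewrite pE subKn; [rewrite ifF//=; lia|lia].
Qed.

End inverse.

(** The surplus over the size is the padding: an index i >= b carries the value [c] in each of the
    (a + b).-1 - i rows below the top that are long enough to contain it. *)
Lemma sum_pp_gt p : p \in PP a b c ->
  sumn (map sumn (pp_gt p)) = (#|` p| + \sum_(b <= i < a + b) c * ((a + b).-1 - i))%N.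
Proof.
move=> pP.
transitivity (\sum_(0 <= i < a + b) \sum_(1 <= r < a + b - i) height p r (b - i))%N.
  rewrite /pp_gt /mkseq -map_comp sumnE big_map.
  transitivity (\sum_(1 <= k < a + b) \sum_(0 <= i < a + b | i < a + b - k)
     height p (a + b - k - i) (b - i))%N.
    rewrite -[X in iota _ X]subn0 -/(index_iota 0 (a + b).-1) big_add1.
    apply: eq_big_nat => k hk /=; rewrite sumnE /pp_row /mkseq big_map.
    rewrite -[X in iota _ X]subn0 -/(index_iota 0 (a + b - k.+1)).
    rewrite (big_nat_widen 0 (a + b - k.+1) (a + b)); last lia.
    by [].
  rewrite (exchange_big_dep_nat xpredT)//=; apply: eq_big_nat => i hi.
  rewrite [RHS]big_nat_rev/= (big_nat_widen 1 (a + b - i) (a + b)); last lia.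
  rewrite big_nat_cond [RHS]big_nat_cond; apply: eq_big => [k|k /andP[hk _]]; first lia.
  by congr height; lia.
rewrite (@big_cat_nat _ _ _ b)/=; [|lia|lia]; congr (_ + _)%N; last first.
  apply: eq_big_nat => i hi; rewrite (eq_big_nat _ _ (F2 := fun=> c)).
    by rewrite sum_nat_const_nat; lia.
  by move=> r hr; rewrite /height (_ : (b - i = 0)%N)//; lia.
rewrite card_heights// exchange_big/= big_add1/= [RHS]big_nat_rev/=.
apply: eq_big_nat => i hi; rewrite add0n.
rewrite (@big_cat_nat _ _ _ a.+1)/=; [|lia|lia].
rewrite [X in (_ + X)%N]big_nat_cond [X in (_ + X)%N]big1 ?addn0.
  by apply: eq_bigr => r _; congr height; lia.
by move=> r hr; rewrite height_gt//; lia.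
Qed.

Lemma sum_PP_gt_sum (R : comNzRingType) (q : R) :
  ((\sum_(p <- PP a b c) q ^+ #|` p|) * q ^+ (\sum_(b <= i < a + b) c * ((a + b).-1 - i))%N
  = gt_sum q (a + b).-1%N top_row)%R.
Proof.
rewrite mulr_suml /gt_sum.
transitivity (\sum_(g <- map pp_gt (PP a b c)) q ^+ sumn (map sumn g))%R.
  by rewrite big_map; apply: eq_big_seq => p pP; rewrite sum_pp_gt// exprD.
apply: perm_big; apply: uniq_perm.
- by rewrite map_inj_in_uniq ?fset_uniq//; exact: pp_gt_inj.
- exact: gt_uniq.
- move=> g; apply/mapP/idP => [[p pP ->]|/pp_gt_onto[p pP <-]]; first exact: pp_gt_in.
  by exists p.
Qed.

End heights.

(** * MacMahon's box formula *)

Section macmahon.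

Lemma vdm_nat (R : comNzRingType) (q : R) n l : vdm q n l =
  \prod_(0 <= i < n) \prod_(i.+1 <= j < n) (q ^+ l j - q ^+ l i).
Proof.
rewrite vdmE big_mkord; apply: eq_bigr => i _.
rewrite (big_nat_widenl i.+1 0 n)//= big_mkord.
by [].
Qed.

Variables (D : idomainType) (q : D).
Hypotheses (q_neq0 : q != 0) (q_neq1 : forall k, (0 < k)%N -> q ^+ k != 1).

Lemma expB_neq0 i j : (i < j)%N -> q ^+ j - q ^+ i != 0.
Proof.
move=> ij; rewrite -(subnKC (ltnW ij)) exprD -[X in _ - X]mulr1 -mulrBr mulf_neq0//.
  by rewrite expf_neq0.
by rewrite subr_eq0 q_neq1// subn_gt0.
Qed.

(** The shifted exponents of the top row form two blocks, 0..b-1 and c+b..c+a+b-1. Pairs inside a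
    block give the same factors as for the zero row, up to powers of q that match the padding
    weight; after cancellation the mixed pairs [E] remain. *)
Lemma sum_PP_prod a b c : (0 < a)%N -> (0 < b)%N ->
  (\sum_(p <- PP a b c) q ^+ #|` p|) *
    \prod_(i < a) \prod_(j < b) (q ^+ (i + j).+1 - 1) =
  \prod_(i < a) \prod_(j < b) (q ^+ (c + i + j).+1 - 1).
Proof.
move=> a0 b0; set F := \sum_(p <- _) _.
have H : F * q ^+ (\sum_(b <= i < a + b) c * ((a + b).-1 - i))%N * vdm q (a + b) id
     = vdm q (a + b) (fun i => nth 0%N (top_row a b c) i + i)%N.
  rewrite sum_PP_gt_sum// -[in LHS](@prednK (a + b)) ?addn_gt0 ?a0//.
  rewrite gt_sum_vdm ?prednK ?addn_gt0 ?a0 ?size_mkseq//.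
  apply/(sortedP 0%N) => i; rewrite size_mkseq => iab; rewrite !nth_mkseq//; last lia.
  by case: ifP => // ib; rewrite ifF//; lia.
pose B := \prod_(0 <= i < b) \prod_(i.+1 <= j < b) (q ^+ j - q ^+ i).
pose A := \prod_(b <= i < a + b) \prod_(i.+1 <= j < a + b) (q ^+ j - q ^+ i).
pose E d := \prod_(0 <= i < b) \prod_(b <= j < a + b) (q ^+ (d + j) - q ^+ i).
have split_prod (l : nat -> nat) : vdm q (a + b) l =
   (\prod_(0 <= i < b) \prod_(i.+1 <= j < b) (q ^+ l j - q ^+ l i)) *
   (\prod_(0 <= i < b) \prod_(b <= j < a + b) (q ^+ l j - q ^+ l i)) *
   \prod_(b <= i < a + b) \prod_(i.+1 <= j < a + b) (q ^+ l j - q ^+ l i).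
  rewrite vdm_nat (@big_cat_nat _ _ _ b)//=; last lia.
  rewrite -big_split/=; congr (_ * _).
  by apply: eq_big_nat => i hi; rewrite (@big_cat_nat _ _ _ b)//=; lia.
have nthlo i : (i < b)%N -> (nth 0%N (top_row a b c) i + i = i)%N.
  by move=> ib; rewrite nth_mkseq ?ib//; lia.
have nthhi i : (b <= i < a + b)%N -> (nth 0%N (top_row a b c) i + i = c + i)%N.
  by move=> ib; rewrite nth_mkseq ?ifF//; lia.
have FE : F * E 0%N = E c.
  move: H; rewrite !split_prod.
  rewrite [X in _ = X * _ * _](_ : _ = B); last first.
    apply: eq_big_nat => i hi; apply: eq_big_nat => j hj.
    by rewrite !nthlo//; lia.
  rewrite [X in _ = _ * X * _](_ : _ = E c); last first.
    apply: eq_big_nat => i hi; apply: eq_big_nat => j hj.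
    by rewrite nthhi// nthlo//; lia.
  rewrite [X in _ = _ * X](_ : _ = q ^+ (\sum_(b <= i < a + b) c * ((a + b).-1 - i))%N * A); last first.
    rewrite expr_sum -big_split/=; apply: eq_big_nat => i hi.
    rewrite exprM (_ : ((a + b).-1 - i = a + b - i.+1)%N); last lia.
    rewrite -prodr_const_nat -big_split/=; apply: eq_big_nat => j hj.
    by rewrite !nthhi ?exprD ?mulrBr//; lia.
  set Q := q ^+ _; rewrite -/B -/A -[\prod_(0 <= i < b) \prod_(b <= j < a + b) _]/(E 0%N).
  move=> H; have nz : Q * B * A != 0.
    rewrite !mulf_neq0//; first by rewrite expf_neq0.
      rewrite /B prodf_seq_neq0; apply/allP => i _ /=.
      rewrite prodf_seq_neq0; apply/allP => j /=; rewrite mem_index_iota => hj.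
      by apply: expB_neq0; lia.
    rewrite /A prodf_seq_neq0; apply/allP => i _ /=.
    rewrite prodf_seq_neq0; apply/allP => j /=; rewrite mem_index_iota => hj.
    by apply: expB_neq0; lia.
  apply: (mulIf nz); transitivity (F * Q * (B * E 0%N * A)); first by ring.
  by rewrite H; ring.
(* Pulling q^i out of a mixed factor leaves the exponent d + j - i; reversing the order of the i and
   shifting j by b turns it into (d + i + j).+1. *)
have EE d : E d = \prod_(0 <= i < b) q ^+ (i * a) *
    \prod_(i < a) \prod_(j < b) (q ^+ (d + i + j).+1 - 1).
  rewrite [X in _ * X]exchange_big/= -(big_mkord xpredT
    (fun i => \prod_(j < a) (q ^+ (d + j + i).+1 - 1))).
  rewrite [X in _ * X]big_nat_rev/= -big_split/=; apply: eq_big_nat => i hi.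
  rewrite -{1}[b]add0n big_addn addnK big_mkord exprM.
  rewrite (_ : (q ^+ i) ^+ a = \prod_(j < a) q ^+ i); last by rewrite prodr_const card_ord.
  rewrite -big_split/=; apply: eq_bigr => j _.
  rewrite mulrBr mulr1 -exprD; congr (q ^+ _ - _); lia.
have qnz : \prod_(0 <= i < b) q ^+ (i * a) != 0.
  by rewrite prodf_seq_neq0; apply/allP => i _ /=; rewrite expf_neq0.
by apply: (mulfI qnz); rewrite mulrCA -[X in _ * X = _](EE 0%N) FE EE.
Qed.

End macmahon.

(** * The generating polynomial of the size and its symmetry in the three sides *)

Section generating_function.
Variable R : idomainType.

Definition pp_gf a b c : {poly R} := \sum_(p <- PP a b c) 'X^(#|` p|).

Let polyXn_neq1 k : (0 < k)%N -> 'X^k != 1 :> {poly R}.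
Proof.
by move=> k0; apply/eqP => /(congr1 (fun p : {poly R} => size p)); rewrite size_polyXn size_poly1; lia.
Qed.

Lemma pp_gf_prod a b c : (0 < a)%N -> (0 < b)%N ->
  pp_gf a b c * \prod_(i < a) \prod_(j < b) ('X^((i + j).+1) - 1) =
  \prod_(i < a) \prod_(j < b) ('X^((c + i + j).+1) - 1).
Proof. by move=> a0 b0; apply: sum_PP_prod => //; rewrite polyX_eq0. Qed.

Let prod_neq0 (I J : finType) (f : I -> J -> nat) :
  \prod_(i : I) \prod_(j : J) ('X^((f i j).+1) - 1) != 0 :> {poly R}.
Proof.
apply/prodf_neq0 => i _; apply/prodf_neq0 => j _.
by rewrite subr_eq0 polyXn_neq1.
Qed.

(** The product over k telescopes to the formula over the a x b rectangle. This form is visibly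
    symmetric in the sides, and the symmetry of [pp_gf] is deduced from it. *)
Lemma pp_gf_prod3 a b c : (0 < a)%N -> (0 < b)%N ->
  pp_gf a b c * \prod_(i < a) \prod_(j < b) \prod_(k < c) ('X^((i + j + k).+1) - 1) =
  \prod_(i < a) \prod_(j < b) \prod_(k < c) ('X^((i + j + k).+2) - 1).
Proof.
move=> a0 b0; apply: (mulIf (prod_neq0 (fun (i : 'I_a) (j : 'I_b) => (i + j)%N))).
rewrite mulrAC pp_gf_prod// -!big_split/=; apply: eq_bigr => i _.
rewrite -!big_split/=; apply: eq_bigr => j _.
elim: c => [|c IH]; first by rewrite !big_ord0 !mulr1 mul1r.
rewrite !big_ord_recr/= [RHS]mulrAC -IH [RHS]mulrC [X in _ = _ * X]mulrC.
rewrite (_ : (c.+1 + i + j).+1 = (i + j + c).+2)%N; last lia.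
by rewrite (_ : (c + i + j).+1 = (i + j + c).+1)%N; last lia.
Qed.

Let prod3_neq0 a b c :
  \prod_(i < a) \prod_(j < b) \prod_(k < c) ('X^((i + j + k).+1) - 1) != 0 :> {poly R}.
Proof. by apply/prodf_neq0 => i _; apply: (prod_neq0 (fun (j : 'I_b) (k : 'I_c) => (i + j + k)%N)). Qed.

Lemma pp_gfC a b c : (0 < a)%N -> (0 < b)%N -> pp_gf a b c = pp_gf b a c.
Proof.
move=> a0 b0; apply: (mulIf (prod3_neq0 a b c)); rewrite pp_gf_prod3//.
rewrite exchange_big [X in _ = _ * X]exchange_big/=.
under eq_bigr do under eq_bigr do under eq_bigr do rewrite (addnC (nat_of_ord _) (nat_of_ord _)).
under [in RHS]eq_bigr do under eq_bigr do under eq_bigr do rewrite (addnC (nat_of_ord _) (nat_of_ord _)).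
by rewrite -pp_gf_prod3.
Qed.

Lemma pp_gfAC a b c : (0 < a)%N -> (0 < b)%N -> (0 < c)%N ->
  pp_gf a b c = pp_gf a c b.
Proof.
move=> a0 b0 c0; apply: (mulIf (prod3_neq0 a b c)); rewrite pp_gf_prod3//.
under eq_bigr do rewrite exchange_big/=.
under [in RHS]eq_bigr do rewrite exchange_big/=.
under eq_bigr do under eq_bigr do under eq_bigr do rewrite addnAC.
under [in RHS]eq_bigr do under eq_bigr do under eq_bigr do rewrite addnAC.
by rewrite -pp_gf_prod3.
Qed.

End generating_function.

Lemma sumr_const_seq (V : nmodType) (I : Type) (s : seq I) (x : V) :
  \sum_(i <- s) x = x *+ size s.
Proof. by rewrite big_const_seq count_predT iter_addr_0. Qed.

(** * Mean and variance read off from generating polynomials *)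

Section poly_moments.
Variable R : realFieldType.
Implicit Types P Q : {poly R}.

(* If [P] is the generating function of a random variable, up to a constant
   factor, these are its mean and its variance. *)
Definition pmean P : R := P^`().[1] / P.[1].
Definition pvar P : R := P^`()^`().[1] / P.[1] + pmean P - pmean P ^+ 2.

Lemma pmeanM P Q : P.[1] != 0 -> Q.[1] != 0 -> pmean (P * Q) = pmean P + pmean Q.
Proof. by move=> p0 q0; rewrite /pmean derivM hornerD !hornerM; field; rewrite p0 q0. Qed.

Lemma pvarM P Q : P.[1] != 0 -> Q.[1] != 0 -> pvar (P * Q) = pvar P + pvar Q.
Proof.
move=> p0 q0; rewrite /pvar pmeanM// /pmean derivM derivD !derivM !hornerD !hornerM.
by field; rewrite p0 q0.
Qed.

Lemma pmean1 : pmean 1 = 0.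
Proof. by rewrite /pmean derivC horner0 mul0r. Qed.

Lemma pvar1 : pvar 1 = 0.
Proof. by rewrite /pvar pmean1 derivC deriv0 horner0 mul0r add0r expr0n subr0. Qed.

Lemma pmean_pvar_prod (I : finType) (F : I -> {poly R}) : (forall i, (F i).[1] != 0) ->
  [/\ (\prod_i F i).[1] != 0, pmean (\prod_i F i) = \sum_i pmean (F i)
    & pvar (\prod_i F i) = \sum_i pvar (F i)].
Proof.
move=> F0; elim: (index_enum I) => [|i s [s0 sm sv]].
  by rewrite !big_nil hornerC oner_eq0 pmean1 pvar1.
by rewrite !big_cons hornerM mulf_neq0// pmeanM// pvarM// sm sv.
Qed.

(** The q-integer: the generating polynomial, up to scaling, of the uniform law on 0..n-1. *)
Definition qint n : {poly R} := \sum_(i < n) 'X^i.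

Lemma subX1_qint n : ('X - 1) * qint n = 'X^n - 1.
Proof. by rewrite -subrX1. Qed.

Lemma qint1 n : (qint n).[1] = n%:R.
Proof.
rewrite /qint horner_sum (eq_bigr (fun=> 1)) => [|i _]; last by rewrite hornerXn expr1n.
by rewrite sumr_const card_ord.
Qed.

Lemma pmean_qint n : pmean (qint n.+1) = n%:R / 2.
Proof.
have d m : (qint m)^`().[1] = m%:R * (m%:R - 1) / 2.
  elim: m => [|m IH]; first by rewrite /qint big_ord0 deriv0 horner0 !mul0r.
  rewrite /qint big_ord_recr/= derivD hornerD -/(qint m) IH derivXn hornerMn hornerXn expr1n.
  by rewrite -natr1; field.
by rewrite /pmean d qint1 -natr1; field; rewrite -?natr1 natr1 pnatr_eq0.
Qed.

Lemma pvar_qint n : pvar (qint n.+1) = (n.+1%:R ^+ 2 - 1) / 12.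
Proof.
have d m : (qint m)^`()^`().[1] = m%:R * (m%:R - 1) * (m%:R - 2) / 3.
  elim: m => [|m IH]; first by rewrite /qint big_ord0 !deriv0 horner0 !mul0r.
  rewrite /qint big_ord_recr/= !derivD hornerD -/(qint m) IH derivXn derivMn derivXn.
  rewrite !hornerMn hornerXn expr1n -mulrnA natrM -natr1.
  by case: m {IH} => [|m]; [|rewrite /= -natr1]; field.
rewrite /pvar pmean_qint d qint1 -natr1; field.
by rewrite natr1 pnatr_eq0.
Qed.

End poly_moments.

(** Used twice: it yields the variance of the size, and it makes the quotient of the Gaussian
    products in the normal limit exactly exp(-t^2/2). *)
Lemma sum_box_sqr (R : realFieldType) (a b c : nat) :
  \sum_(l : 'I_a * 'I_b) ((c + l.1 + l.2).+1%:R ^+ 2 - (l.1 + l.2).+1%:R ^+ 2) =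
  (a * b * c * (a + b + c))%:R :> R.
Proof.
pose G (i j : nat) : R := (c + i + j).+1%:R ^+ 2 - (i + j).+1%:R ^+ 2.
rewrite -(pair_bigA _ (fun (i : 'I_a) (j : 'I_b) => G i j))/=.
have Gj i n : \sum_(j < n) G i j = n%:R * c%:R * (c%:R + 2 * i%:R + 1 + n%:R).
  elim: n => [|n IH]; first by rewrite big_ord0 !mul0r.
  by rewrite big_ord_recr/= IH /G; ring.
under eq_bigr do rewrite Gj.
elim: a => [|n IH]; first by rewrite big_ord0 !mul0n.
by rewrite big_ord_recr/= IH; ring.
Qed.

Section pp_moments.
Variables (R : realFieldType) (a b c : nat).
Hypotheses (a0 : (0 < a)%N) (b0 : (0 < b)%N).
Local Notation F := (pp_gf R a b c).

(** Cancelling one factor X - 1 per cell permits evaluation at 1. In probabilistic terms, the size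
    plus independent uniforms has the law of another sum of independent uniforms, so mean and
    variance follow by subtraction. *)
Lemma pp_gf_qint :
  F * \prod_(l : 'I_a * 'I_b) qint R (l.1 + l.2).+1 =
  \prod_(l : 'I_a * 'I_b) qint R (c + l.1 + l.2).+1.
Proof.
have nz : ('X - 1 : {poly R}) ^+ #|{: 'I_a * 'I_b}| != 0.
  by rewrite expf_neq0// -polyC1 polyXsubC_eq0.
apply: (mulfI nz); rewrite mulrCA -prodr_const -!big_split/=.
under eq_bigr do rewrite subX1_qint.
under [RHS]eq_bigr do rewrite subX1_qint.
by have := pp_gf_prod R c a0 b0; rewrite !pair_bigA.
Qed.

Lemma pp_gf1 : F.[1] = #|` PP a b c|%:R.
Proof.
rewrite /pp_gf horner_sum (eq_bigr (fun=> 1)) => [|p _]; last by rewrite hornerXn expr1n.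
by rewrite sumr_const_seq.
Qed.

Let F1 : F.[1] != 0.
Proof. by rewrite pp_gf1 pnatr_eq0 -lt0n card_PP_gt0. Qed.

Lemma card_PP_prod :
  #|` PP a b c|%:R * \prod_(l : 'I_a * 'I_b) (l.1 + l.2).+1%:R =
  \prod_(l : 'I_a * 'I_b) (c + l.1 + l.2).+1%:R :> R.
Proof.
have := congr1 (horner^~ 1) pp_gf_qint.
rewrite /= hornerM pp_gf1 !horner_prod.
by under eq_bigr do rewrite qint1; under [RHS]eq_bigr do rewrite qint1.
Qed.

Let qint_neq0 n : (qint R n.+1).[1] != 0.
Proof. by rewrite qint1 pnatr_eq0. Qed.

Let moments_F : pmean F = (a * b * c)%:R / 2 /\
  pvar F = (a * b * c * (a + b + c))%:R / 12.
Proof.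
have [n0 nm nv] := pmean_pvar_prod (fun l : 'I_a * 'I_b => qint_neq0 (l.1 + l.2)).
have [m0 mm mv] := pmean_pvar_prod (fun l : 'I_a * 'I_b => qint_neq0 (c + l.1 + l.2)).
move: mm mv; rewrite -pp_gf_qint pmeanM// pvarM// nm nv => em ev; split.
  apply: (addIr (\sum_(l : 'I_a * 'I_b) pmean (qint R (l.1 + l.2).+1))); rewrite em.
  under eq_bigr do rewrite pmean_qint.
  under [in RHS]eq_bigr do rewrite pmean_qint.
  under eq_bigr do rewrite -addnA natrD mulrDl.
  by rewrite big_split/= sumr_const card_prod !card_ord -mulr_natr !natrM; ring.
apply: (addIr (\sum_(l : 'I_a * 'I_b) pvar (qint R (l.1 + l.2).+1))); rewrite ev.
under eq_bigr do rewrite pvar_qint.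
under [in RHS]eq_bigr do rewrite pvar_qint.
rewrite -sum_box_sqr mulr_suml -big_split/=; apply: eq_bigr => l _.
by field.
Qed.

Lemma sum_PP_size : \sum_(p <- PP a b c) #|` p|%:R / #|` PP a b c|%:R = (a * b * c)%:R / 2 :> R.
Proof.
have [<- _] := moments_F; rewrite /pmean pp_gf1 -mulr_suml; congr (_ / _).
rewrite /pp_gf raddf_sum horner_sum/=; apply: eq_bigr => p _.
by rewrite derivXn hornerMn hornerXn expr1n.
Qed.

Lemma sum_PP_size_var :
  \sum_(p <- PP a b c) (#|` p|%:R - (a * b * c)%:R / 2) ^+ 2 / #|` PP a b c|%:R =
  (a * b * c * (a + b + c))%:R / 12 :> R.
Proof.
have [mF vF] := moments_F; rewrite -vF /pvar -mF.
have n0 : #|` PP a b c|%:R != 0 :> R by rewrite pnatr_eq0 -lt0n card_PP_gt0.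
have D1 : F^`().[1] = \sum_(p <- PP a b c) #|` p|%:R.
  rewrite /pp_gf raddf_sum horner_sum/=; apply: eq_bigr => p _.
  by rewrite derivXn hornerMn hornerXn expr1n.
have D2 : F^`()^`().[1] = \sum_(p <- PP a b c) (#|` p|%:R ^+ 2 - #|` p|%:R).
  rewrite /pp_gf !raddf_sum horner_sum/=; apply: eq_bigr => p _.
  rewrite derivXn derivMn derivXn !hornerMn hornerXn expr1n -mulrnA natrM.
  by case: #|` p| => [|n]; rewrite /= -?natr1; ring.
rewrite D2 -mulr_suml sumrB -D1 mulrBl -pp_gf1.
rewrite (_ : F^`().[1] / F.[1] = pmean F)//.
rewrite (eq_bigr (fun p : cubes => #|` p|%:R ^+ 2 - (#|` p|%:R * (pmean F *+ 2) - pmean F ^+ 2))); last first.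
  by move=> p _; ring.
rewrite !sumrB -mulr_suml -D1 (_ : \sum_(i <- _) pmean F ^+ 2 = pmean F ^+ 2 * F.[1]); last first.
  by rewrite pp_gf1 sumr_const_seq mulr_natr.
by rewrite /pmean; field.
Qed.

End pp_moments.

(** * Trigonometric form of the box formula *)

Section cis.
Variable R : realType.
Local Open Scope complex_scope.

Definition cis (x : R) : R[i] := cos x +i* sin x.

Lemma cisD x y : cis (x + y) = cis x * cis y.
Proof.
rewrite /cis cosD sinD; apply/eqP; rewrite eq_complex/=.
by rewrite eqxx/=; apply/eqP; ring.
Qed.

Lemma cis0 : cis 0 = 1.
Proof. by rewrite /cis cos0 sin0. Qed.

Lemma cis_neq0 x : cis x != 0.
Proof.
apply/eqP => /(congr1 (fun z => z * cis (- x))); rewrite -cisD subrr cis0 mul0r.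
by move/eqP; rewrite oner_eq0.
Qed.

Lemma cisX x n : cis x ^+ n = cis (x *+ n).
Proof. by elim: n => [|n IH]; rewrite ?cis0// exprS mulrS cisD IH. Qed.

Lemma cis_sum (I : Type) (s : seq I) (f : I -> R) :
  \prod_(i <- s) cis (f i) = cis (\sum_(i <- s) f i).
Proof. by elim/big_rec2: _ => [|i y z _ ->]; rewrite ?cis0// cisD. Qed.

Lemma cis2_sub1 x : cis (x *+ 2) - 1 = 2 * 'i * (sin x)%:C * cis x.
Proof.
apply/eqP; rewrite eq_complex /cis cos_mulr2n sin_mulr2n/=; apply/andP; split.
  by apply/eqP; rewrite cos2sin2; ring.
by apply/eqP; ring.
Qed.

Lemma Re_sum (I : Type) (s : seq I) (f : I -> R[i]) :
  complex.Re (\sum_(i <- s) f i) = \sum_(i <- s) complex.Re (f i).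
Proof.
elim: s => [|i s IH]; first by rewrite !big_nil.
by rewrite !big_cons -IH; case: (f i) => ? ?; case: (\sum_(j <- s) f j).
Qed.

Lemma Re_mulrC (z : R[i]) (x : R) : complex.Re (z * x%:C) = complex.Re z * x.
Proof. by case: z => u v /=; rewrite mulr0 subr0. Qed.

End cis.

Section sinc.
Variable R : realType.

Definition sinc (x : R) : R := if x == 0 then 1 else sin x / x.

Lemma sincE x : sin x = sinc x * x.
Proof. by rewrite /sinc; case: eqP => [->|/eqP x0]; rewrite ?sin0 ?mulr0// divfK. Qed.

End sinc.

Section pp_cos.
Variables (R : realType) (a b c : nat).
Hypotheses (a0 : (0 < a)%N) (b0 : (0 < b)%N).

(** Evaluate the box formula at q = e^(2ix), where q^n - 1 = 2i sin(nx) e^(inx). The factors 2i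
    cancel, and the phases differ by e^(i abc x), which centres the size at abc/2; rotating by u and
    taking real parts gives the claim. *)
Lemma sum_PP_cos_sin (x u : R) :
  (\sum_(p <- PP a b c) cos ((#|` p|%:R - (a * b * c)%:R / 2) * (x *+ 2) + u)) *
    \prod_(l : 'I_a * 'I_b) sin ((l.1 + l.2).+1%:R * x) =
  cos u * \prod_(l : 'I_a * 'I_b) sin ((c + l.1 + l.2).+1%:R * x).
Proof.
have := congr1 (horner^~ (cis (x *+ 2))) (pp_gf_prod R[i] c a0 b0).
rewrite /= !pair_bigA/= hornerM /pp_gf horner_sum !horner_prod.
have E n : ('X^(n.+1) - 1 : {poly R[i]}).[cis (x *+ 2)] =
   2 * 'i%C * (sin (n.+1%:R * x))%:C%C * cis (n.+1%:R * x).
  rewrite hornerD hornerN hornerXn hornerC cisX -mulrnA mulnC mulrnA.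
  by rewrite -cis2_sub1 mulr_natl.
under [X in _ * X = _ -> _]eq_bigr do rewrite E.
under [X in _ = X -> _]eq_bigr do rewrite E.
under [X in X * _ = _ -> _]eq_bigr do rewrite hornerXn.
rewrite !big_split/= !cis_sum => H.
set sn := \sum_(l : 'I_a * 'I_b) (l.1 + l.2).+1%:R * x in H.
have es : \sum_(l : 'I_a * 'I_b) (c + l.1 + l.2).+1%:R * x = sn + (a * b * c)%:R * x.
  rewrite /sn; under eq_bigr do rewrite -addnA -addnS natrD mulrDl.
  rewrite big_split/= addrC; congr (_ + _).
  by rewrite sumr_const card_prod !card_ord -[LHS]mulr_natl mulrA -natrM.
rewrite es (cisD sn) in H.
set I2 := \prod_(i : 'I_a * 'I_b) 2 in H; set I1 := \prod_(i : 'I_a * 'I_b) 'i%C in H.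
have nz : I2 * I1 * cis sn != 0.
  rewrite !mulf_neq0 ?cis_neq0//; apply/prodf_neq0 => l _.
    by rewrite pnatr_eq0.
  by rewrite eq_complex/= oner_eq0 andbF.
have {H} : (\sum_(p <- PP a b c) cis (x *+ 2) ^+ #|` p|) *
     (\prod_(l : 'I_a * 'I_b) sin ((l.1 + l.2).+1%:R * x))%:C%C =
   (\prod_(l : 'I_a * 'I_b) sin ((c + l.1 + l.2).+1%:R * x))%:C%C * cis ((a * b * c)%:R * x).
  apply: (mulIf nz); rewrite !rmorph_prod/=.
  move: H; set A := \sum_(i <- _) _.
  set B := \prod_(i : 'I_a * 'I_b) (sin ((i.1 + i.2).+1%:R * x))%:C%C.
  set D := \prod_(i : 'I_a * 'I_b) (sin ((c + i.1 + i.2).+1%:R * x))%:C%C.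
  move=> H; transitivity (A * (I2 * I1 * B * cis sn)); first by ring.
  by rewrite H; ring.
move/(congr1 (fun z => complex.Re (z * cis (u - (a * b * c)%:R * x)))).
rewrite mulrAC Re_mulrC mulr_suml Re_sum => H.
have -> : \sum_(p <- PP a b c) cos ((#|` p|%:R - (a * b * c)%:R / 2) * (x *+ 2) + u) =
   \sum_(p <- PP a b c) complex.Re (cis (x *+ 2) ^+ #|` p| * cis (u - (a * b * c)%:R * x)).
  apply: eq_bigr => p _; rewrite cisX -cisD /=; congr cos.
  by rewrite -(mulr_natl _ #|` p|) mulr2n; field.
by rewrite H -mulrA -cisD [(a * b * c)%:R * x + _]addrC subrK mulrC Re_mulrC.
Qed.

(** Dividing each sine by its argument normalizes the sum, because the quotient of the products of
    arguments is the number of plane partitions ([card_PP_prod]). *)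
Lemma sum_PP_cos (x u : R) :
  (\sum_(p <- PP a b c)
     cos ((#|` p|%:R - (a * b * c)%:R / 2) * (x *+ 2) + u) / #|` PP a b c|%:R) *
    \prod_(l : 'I_a * 'I_b) sinc ((l.1 + l.2).+1%:R * x) =
  cos u * \prod_(l : 'I_a * 'I_b) sinc ((c + l.1 + l.2).+1%:R * x).
Proof.
have n0 : #|` PP a b c|%:R != 0 :> R by rewrite pnatr_eq0 -lt0n card_PP_gt0.
have [->|x0] := eqVneq x 0.
  rewrite [X in _ * X]big1 => [|l _]; last by rewrite mulr0 /sinc eqxx.
  rewrite [X in _ = _ * X]big1 => [|l _]; last by rewrite mulr0 /sinc eqxx.
  rewrite !mulr1.
  rewrite (eq_bigr (fun=> cos u / #|` PP a b c|%:R)) => [|p _]; last first.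
    by rewrite mul0rn mulr0 add0r.
  by rewrite sumr_const_seq -[LHS]mulr_natr mulfVK.
have := sum_PP_cos_sin x u.
under [X in _ * X = _]eq_bigr do rewrite sincE mulrA.
under [X in _ = _ * X]eq_bigr do rewrite sincE mulrA.
rewrite !big_split/= -card_PP_prod// -mulr_suml.
set S := \sum_(p <- _) _; set A := \prod_(i : 'I_a * 'I_b) sinc _; set B := \prod_(i : 'I_a * 'I_b) sinc _.
set N := \prod_(i : 'I_a * 'I_b) _.+1%:R; set X := \prod_(i : 'I_a * 'I_b) x; move=> H.
have N0 : N != 0 by apply/prodf_neq0 => l _; rewrite pnatr_eq0.
have X0 : X != 0 by apply/prodf_neq0.
apply: (mulIf (mulf_neq0 (mulf_neq0 N0 X0) n0)).
transitivity (S * (A * N * X)); first by field.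
by rewrite H; ring.
Qed.

End pp_cos.

(** * Expectation, variance and tails under the uniform law *)

Section uniform_PP_expectation.
Variables (R : realType) (a b c : nat).
Local Notation P := (@uniform_PP R a b c).

Lemma uniform_PP1 (p : cubes) : p \in PP a b c -> P [set p] = (#|` PP a b c|%:R^-1)%:E.
Proof.
rewrite /uniform_PP; move: (PP a b c) => Q pQ.
rewrite (_ : [fset _ in _ | _]%fset = [fset p]%fset) ?cardfs1 ?mul1r//.
apply/fsetP => r; rewrite !inE/=; have [->|/eqP rp] := eqVneq r p.
  by rewrite pQ mem_set.
by rewrite memNset ?andbF.
Qed.

Lemma integral_uniform_PP (f : cubes -> R) :
  (\int[P]_p (f p)%:E = (\sum_(p <- PP a b c) f p / #|` PP a b c|%:R)%:E)%E.
Proof.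
(* Off the null set complementary to [PP a b c], [f] is a finite combination of indicators of
   points. *)
transitivity (\int[P]_p (\sum_(r <- PP a b c) (f r * \1_[set r] p)%:E))%E.
  apply: ae_eq_integral => //; exists (~` [set` PP a b c]); split => //.
    rewrite /= /uniform_PP; move: (PP a b c) => Q.
    rewrite (_ : [fset _ in _ | _]%fset = fset0) ?cardfs0 ?mul0r//.
    by apply/fsetP => r; rewrite !inE/=; apply/negP => /andP[+ /set_mem]; rewrite /= => ->.
  move=> p /= h pP; apply: h => _.
  rewrite (big_fsetD1 p)//= indicE mem_set//= mulr1 big1_seq ?adde0// => r.
  rewrite !inE => /andP[_ /andP[rp _]]; rewrite indicE memNset ?mulr0//= => pr.
  by rewrite pr eqxx in rp.
rewrite integral_sum//; last first.
  move=> r; rewrite (_ : (fun p => _) = (fun p => (f r)%:E * (\1_[set r] p)%:E)%E); last first.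
    by apply/funext => p; rewrite EFinM.
  by apply: integrableZl => //; apply: integrable_indic.
rewrite -sumEFin; apply: eq_big_seq => r rP.
under eq_integral do rewrite EFinM.
rewrite integralZl//; last exact: integrable_indic.
by rewrite integral_indic// setIT EFinM; congr (_ * _)%E; exact: uniform_PP1.
Qed.

Lemma Rintegral_uniform_PP (f : cubes -> R) :
  \int[P]_p f p = \sum_(p <- PP a b c) f p / #|` PP a b c|%:R.
Proof. by rewrite /Rintegral integral_uniform_PP. Qed.

Hypotheses (a0 : (0 < a)%N) (b0 : (0 < b)%N) (c0 : (0 < c)%N).

Definition pp_mu : R := (a * b * c)%:R / 2.
Definition pp_var : R := (a * b * c * (a + b + c))%:R / 12.

Lemma pp_var_gt0 : 0 < pp_var.
Proof. by rewrite divr_gt0// ltr0n !muln_gt0 a0 b0 c0 !addn_gt0 a0. Qed.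

Lemma expectation_size : ('E_P[@size_rv R a b c] = pp_mu%:E)%E.
Proof. by rewrite unlock integral_uniform_PP sum_PP_size. Qed.

Lemma variance_size : ('V_P[@size_rv R a b c] = pp_var%:E)%E.
Proof.
rewrite /variance unlock expectation_size unlock.
under eq_integral => p _.
  rewrite (_ : (_ * _) p = ((pp_size p : R) - pp_mu) ^+ 2); last by [].
  over.
by rewrite integral_uniform_PP sum_PP_size_var.
Qed.

Lemma standardize_sizeE (p : cubes) : standardize (@size_rv R a b c) p =
  (#|` p|%:R - pp_mu) / Num.sqrt pp_var.
Proof. by rewrite /standardize/= /standardize_fun expectation_size variance_size. Qed.

(** The angle in [sum_PP_cos] is doubled, whence the 2 next to the standard deviation. *)
Lemma expectation_cos_size (t u : R) :
  (\int[P]_p cos (t * standardize (@size_rv R a b c) p + u)) *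
    \prod_(l : 'I_a * 'I_b) sinc ((l.1 + l.2).+1%:R * (t / (2 * Num.sqrt pp_var))) =
  cos u * \prod_(l : 'I_a * 'I_b) sinc ((c + l.1 + l.2).+1%:R * (t / (2 * Num.sqrt pp_var))).
Proof.
rewrite -sum_PP_cos// Rintegral_uniform_PP; congr (_ * _).
apply: eq_bigr => p _; congr (cos _ / _); rewrite standardize_sizeE.
have s0 : Num.sqrt pp_var != 0 by rewrite gt_eqF// sqrtr_gt0 pp_var_gt0.
by rewrite mulr2n /pp_mu; field.
Qed.

Lemma standardize_size_tight (A : R) : 0 < A ->
  (P [set p | A < `|standardize (@size_rv R a b c) p| ]%R <= (A ^- 2)%:E)%E.
Proof.
move=> A0; have v0 := pp_var_gt0.
have s0 : 0 < Num.sqrt pp_var by rewrite sqrtr_gt0.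
have e0 : 0 < A * Num.sqrt pp_var by rewrite mulr_gt0.
have := chebyshev (@size_rv R a b c) e0.
rewrite expectation_size variance_size exprMn sqr_sqrtr; last exact: ltW.
rewrite -EFinM.
rewrite invfM -mulrA mulVf ?gt_eqF// mulr1; apply: le_trans.
apply: le_measure; rewrite ?inE// => p /=; rewrite standardize_sizeE normrM normfV.
by rewrite (gtr0_norm s0) ltr_pdivlMr// => /ltW.
Qed.

End uniform_PP_expectation.

(** * Linear combinations of integrable real functions *)

Section real_integrable.
Context d (T : measurableType d) (R : realType) (mu : {measure set T -> \bar R}).
Implicit Types f g : T -> R.

Lemma integrable_mulrl f (r : R) : mu.-integrable setT (EFin \o f) ->
  mu.-integrable setT (EFin \o (fun x => r * f x)).
Proof.
move=> fi; rewrite (_ : _ \o _ = (fun x => r%:E * (f x)%:E)%E); last first.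
  by apply/funext => x /=; rewrite EFinM.
exact: integrableZl.
Qed.

Lemma integrable_addr f g : mu.-integrable setT (EFin \o f) ->
  mu.-integrable setT (EFin \o g) -> mu.-integrable setT (EFin \o (fun x => f x + g x)).
Proof.
move=> fi gi; rewrite (_ : _ \o _ = (fun x => (f x)%:E + (g x)%:E)%E); last first.
  by apply/funext => x /=; rewrite EFinD.
exact: integrableD.
Qed.

Lemma integrable_subr f g : mu.-integrable setT (EFin \o f) ->
  mu.-integrable setT (EFin \o g) -> mu.-integrable setT (EFin \o (fun x => f x - g x)).
Proof.
move=> fi gi; rewrite (_ : _ \o _ = (fun x => (f x)%:E - (g x)%:E)%E); last first.
  by apply/funext => x /=; rewrite EFinB.
exact: integrableB.
Qed.

End real_integrable.

(** * Polynomial approximation of a step on [0, 1] *)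

Section step_approximation.
Variable R : realType.
Implicit Types s e eta : R.

Lemma bernoulli_ineq (x : R) n : -1 <= x -> 1 + n%:R * x <= (1 + x) ^+ n.
Proof.
move=> x1; elim: n => [|n IH]; first by rewrite mul0r addr0 expr0.
have h : 0 <= 1 + x by lra.
have h2 : 0 <= n%:R * x ^+ 2 by rewrite mulr_ge0 ?ler0n ?sqr_ge0.
rewrite exprS; apply: le_trans (ler_wpM2l h IH).
by rewrite -natr1; nra.
Qed.

Lemma step_low s n : 0 <= s <= 1 -> 1 - (2 * s) ^+ n <= (1 - s ^+ n) ^+ (2 ^ n).
Proof.
move=> /andP[s0 s1].
have := @bernoulli_ineq (- s ^+ n) (2 ^ n)%N; rewrite lerN2 exprn_ile1// => /(_ isT).
by rewrite natrX mulrN -exprMn.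
Qed.

Lemma step_high s n : 0 <= s <= 1 -> (1 - s ^+ n) ^+ (2 ^ n) * (2 * s) ^+ n <= 1.
Proof.
move=> /andP[s0 s1]; set m := (2 ^ n)%N; set u := s ^+ n.
have u0 : 0 <= u by rewrite exprn_ge0.
have u1 : u <= 1 by rewrite exprn_ile1.
have h : (2 * s) ^+ n <= (1 + u) ^+ m.
  apply: le_trans (bernoulli_ineq m _); last by lra.
  by rewrite /m natrX exprMn -/u; lra.
apply: le_trans (ler_wpM2l _ h) _; first by rewrite exprn_ge0// subr_ge0.
by rewrite -exprMn; apply: exprn_ile1; nra.
Qed.

Lemma step_exists eta e : 0 < eta <= 1 -> 0 < e -> exists n, forall s,
  (0 <= s <= (1 - eta) / 2 -> 1 - e <= (1 - s ^+ n) ^+ (2 ^ n)) /\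
  ((1 + eta) / 2 <= s <= 1 -> (1 - s ^+ n) ^+ (2 ^ n) <= e).
Proof.
move=> /andP[eta0 eta1] e0; set z := 1 - eta / 2.
have z1 : `|z| < 1 by rewrite ger0_norm /z; lra.
have := cvg_expr z1 => /cvgrPdist_le/(_ _ e0)[n _ /(_ n (leqnn n))].
rewrite /= sub0r normrN ger0_norm; last by rewrite exprn_ge0// /z; lra.
move=> zn; exists n => s; split => /andP[h1 h2].
  apply: le_trans (step_low n _); last by lra.
  suff : (2 * s) ^+ n <= z ^+ n by lra.
  by apply: lerXn2r; rewrite ?nnegrE /z; lra.
have s01 : 0 <= s <= 1 by lra.
have zs : 1 <= (2 * s) ^+ n * z ^+ n.
  by rewrite -exprMn; apply: exprn_ege1; rewrite /z; nra.
have g0 : 0 <= (1 - s ^+ n) ^+ (2 ^ n).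
  by rewrite exprn_ge0// subr_ge0 exprn_ile1//; lra.
have := step_high n s01; set g := (1 - _) ^+ _ in g0 *; set p := (2 * s) ^+ n in zs * => gp.
have z0 : 0 <= z ^+ n by rewrite exprn_ge0// /z; lra.
apply: le_trans zn; rewrite -[leLHS]mulr1; apply: le_trans (ler_wpM2l g0 zs) _.
by rewrite mulrA; apply: ler_piMl.
Qed.

(** Pointwise form of the cdf bounds, here and in [le_indicator]: [i] is the half-line event and [j]
    the tail event, on which the approximant is only known to lie in [0, 1]. *)
Lemma indicator_le e (i j : bool) (z : R) : 0 <= e -> 0 <= z ->
  j \/ (~~ i \/ 1 - e <= z) -> i%:R <= z + (e + j%:R).
Proof. by move=> e0; case: i j => [] [] /= z0 [|[|]] //= ?; lra. Qed.

Lemma le_indicator e (i j : bool) (z : R) : 0 <= e -> z <= 1 ->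
  j \/ (i \/ z <= e) -> z <= i%:R + (e + j%:R).
Proof. by move=> e0; case: i j => [] [] /= z1 [|[|]] //= ?; lra. Qed.

End step_approximation.

(** * From cosine expectations to convergence in distribution *)

Section continuity_theorem.
Variable R : realType.

Section one_variable.
Context d (T : measurableType d) (P : probability T R) (X : {RV P >-> R}).

Lemma bounded_RV_integrable (g : R -> R) (K : R) :
  measurable_fun setT g -> (forall y, `|g y| <= K) ->
  P.-integrable setT (EFin \o (fun w => g (X w))).
Proof.
move=> mg gK; apply: measurable_bounded_integrable => //.
- by rewrite -ge0_fin_numE// fin_num_measure.
- exact: measurableT_comp.
- exists K; split; first exact: num_real.
  by move=> M KM w _; apply: le_trans (gK _) (ltW KM).
Qed.

Lemma measurable_tail (A : R) : measurable [set w | A < `|X w| ].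
Proof.
rewrite (_ : [set w | _] = (fun w => `|X w|) @^-1` `]A, +oo[).
  by rewrite -[X in measurable X]setTI; apply: measurableT_comp.
by apply/seteqP; split => w /=; rewrite in_itv/= andbT.
Qed.

Lemma cdfE (x : R) : cdf X x = (\int[P]_w \1_[set w | X w <= x] w)%:E.
Proof.
have mA : measurable [set w | X w <= x].
  rewrite (_ : [set w | X w <= x] = X @^-1` `]-oo, x]).
    exact: measurable_funPTI.
  by apply/seteqP; split => w /=; rewrite in_itv.
by rewrite /Rintegral integral_indic// setIT fineK ?fin_num_measure.
Qed.

Variables (g : R -> R) (x delta A e : R).
Hypothesis mg : measurable_fun setT g.
Hypothesis g01 : forall y, 0 <= g y <= 1.
Hypothesis glo : forall y, `|y| <= A -> y <= x -> 1 - e <= g y.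
Hypothesis ghi : forall y, `|y| <= A -> x + delta <= y -> g y <= e.
Hypothesis e0 : 0 <= e.
Hypothesis tight : (P [set w | A < `|X w| ]%R <= e%:E)%E.

Let mtail : measurable [set w | A < `|X w| ].
Proof. exact: measurable_tail. Qed.

Let mle z : measurable [set w | X w <= z].
Proof.
rewrite (_ : [set w | X w <= z] = X @^-1` `]-oo, z]).
  exact: measurable_funPTI.
by apply/seteqP; split => w /=; rewrite in_itv.
Qed.

Let ig : P.-integrable setT (EFin \o (fun w => g (X w))).
Proof.
apply: (@bounded_RV_integrable _ 1) => // y; have /andP[g0 g1] := g01 y.
by rewrite ger0_norm.
Qed.

Let ind (B : set T) : measurable B -> P.-integrable setT (EFin \o \1_B).
Proof. exact: integrable_indic. Qed.

Let tail_le : \int[P]_w \1_[set w | A < `|X w| ] w <= e.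
Proof.
rewrite /Rintegral integral_indic// setIT -lee_fin fineK ?fin_num_measure//.
Qed.

Let slack : P.-integrable setT (EFin \o (fun w => e + \1_[set w | A < `|X w| ] w)).
Proof.
apply: integrable_addr; last exact: ind.
exact: finite_measure_integrable_cst.
Qed.

Let slackE : \int[P]_w (e + \1_[set w | A < `|X w| ] w) <= e *+ 2.
Proof.
rewrite RintegralD//; [|exact: finite_measure_integrable_cst|exact: ind].
rewrite Rintegral_cst//; have -> : fine (P [set: T]) = 1 by rewrite probability_setT.
by rewrite mulr1 mulr2n lerD2l.
Qed.

(** One [e] pays for the approximation on [-A, A], the other for the mass outside. *)
Lemma cdf_le_expectation : fine (cdf X x) <= \int[P]_w g (X w) + e *+ 2.
Proof.
rewrite cdfE/=; apply: (@le_trans _ _ (\int[P]_w (g (X w) + (e + \1_[set w | A < `|X w| ] w)))).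
  apply: le_Rintegral => //; first exact: ind.
    exact: integrable_addr.
  move=> w _; rewrite !indicE; have /andP[g0 g1] := g01 (X w).
  case: (boolP (w \in [set w | A < _])) => [_|/negP wA].
    by apply: indicator_le => //; left.
  have {}wA : `|X w| <= A.
    by rewrite leNgt; apply/negP => h; apply: wA; rewrite inE.
  apply: indicator_le => //; right.
  case: (boolP (w \in [set w | X w <= x])) => [|_]; last by left.
  by rewrite inE/= => h; right; exact: glo.
by rewrite RintegralD// lerD2l.
Qed.

Lemma expectation_le_cdf : \int[P]_w g (X w) <= fine (cdf X (x + delta)) + e *+ 2.
Proof.
rewrite cdfE/=.
apply: (@le_trans _ _ (\int[P]_w (\1_[set w | X w <= x + delta] w + (e + \1_[set w | A < `|X w| ] w)))).
  apply: le_Rintegral => //.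
    by apply: integrable_addr => //; exact: ind.
  move=> w _; rewrite !indicE; have /andP[g0 g1] := g01 (X w).
  case: (boolP (w \in [set w | A < _])) => [_|/negP wA].
    by apply: le_indicator => //; left.
  have {}wA : `|X w| <= A.
    by rewrite leNgt; apply/negP => h; apply: wA; rewrite inE.
  apply: le_indicator => //; right.
  case: (boolP (w \in [set w | X w <= x + delta])) => [_|/negP h]; first by left.
  by right; apply: ghi => //; rewrite leNgt; apply/negP => h'; apply: h; rewrite inE/= ltW.
by rewrite RintegralD//; [rewrite lerD2l|exact: ind].
Qed.

End one_variable.
End continuity_theorem.

Lemma measurable_cos_affine (R : realType) (t u : R) :
  measurable_fun setT (fun y : R => cos (t * y + u)).
Proof.
apply: continuous_measurable_fun => y.
apply: continuous_comp; last exact: continuous_cos.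
by apply: cvgD; [apply: cvgMr; exact: cvg_id|exact: cvg_cst].
Qed.

Section cos_convergence.
Context (R : realType) (d : nat -> measure_display) (T : forall n, measurableType (d n))
  (P : forall n, probability (T n) R) (X : forall n, {RV (P n) >-> R})
  (d' : measure_display) (T' : measurableType d') (Q : probability T' R)
  (Y : {RV Q >-> R}).

Definition cvg_expectation (g : R -> R) :=
  [/\ measurable_fun setT g, exists K, forall y, `|g y| <= K &
    \int[P n]_w g (X n w) @[n --> \oo] --> \int[Q]_w g (Y w)].

Lemma cvg_expectation_lin (g h : R -> R) (k l : R) :
  cvg_expectation g -> cvg_expectation h ->
  cvg_expectation (fun y => k * g y + l * h y).
Proof.
move=> [mg [K gK] cg] [mh [L hL] ch]; split.
- by apply: measurable_funD; apply: measurable_funM.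
- exists (`|k| * K + `|l| * L) => y; rewrite (le_trans (ler_normD _ _))// !normrM.
  by apply: lerD; apply: ler_wpM2l.
have E d0 (T0 : measurableType d0) (P0 : probability T0 R) (Z : {RV P0 >-> R}) :
   \int[P0]_w (k * g (Z w) + l * h (Z w)) =
   k * \int[P0]_w g (Z w) + l * \int[P0]_w h (Z w).
  have ig := bounded_RV_integrable Z mg gK.
  have ih := bounded_RV_integrable Z mh hL.
  rewrite RintegralD//; [|exact: integrable_mulrl..].
  by rewrite !RintegralZl.
under eq_cvg do rewrite E.
by rewrite E; apply: cvgD; apply: cvgMr.
Qed.

Hypothesis cvg_cos : forall t u : R,
  \int[P n]_w cos (t * X n w + u) @[n --> \oo] --> \int[Q]_w cos (t * Y w + u).

Lemma cvg_expectation_cos t u : cvg_expectation (fun y => cos (t * y + u)).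
Proof.
split; [exact: measurable_cos_affine| |exact: cvg_cos].
by exists 1 => y; exact: cos_max.
Qed.

(** Product-to-sum writes sin B cos A as two cosines with new frequencies and phases, the phase pi/2
    absorbing the sines; hence the induction on [n] keeps [t] and [u] general. *)
Lemma cvg_expectation_sinX_cos (om v : R) n t u :
  cvg_expectation (fun y => ((1 + sin (om * y + v)) / 2) ^+ n * cos (t * y + u)).
Proof.
elim: n t u => [|n IH] t u.
  under eq_fun do rewrite expr0 mul1r.
  exact: cvg_expectation_cos.
have h1 := cvg_expectation_lin (4^-1) (4^-1)
  (IH (t + om) (u + v - pi / 2)) (IH (t - om) (u - v + pi / 2)).
have := cvg_expectation_lin (2^-1) 1 (IH t u) h1; congr cvg_expectation.
apply/funext => y; rewrite exprSr.
have -> : (t + om) * y + (u + v - pi / 2) = (t * y + u) + (om * y + v) - pi / 2 by ring.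
have -> : (t - om) * y + (u - v + pi / 2) = (t * y + u) - (om * y + v) + pi / 2 by ring.
move: (om * y + v) (t * y + u) => B A.
by rewrite cosBpihalf cosDpihalf sinD sinB; field.
Qed.

Lemma cvg_expectation_poly (om v : R) (p : {poly R}) :
  cvg_expectation (fun y => p.[(1 + sin (om * y + v)) / 2]).
Proof.
under eq_fun do rewrite horner_coef.
elim: (size p) => [|n IH].
  have := cvg_expectation_lin 0 0 (cvg_expectation_cos 0 0) (cvg_expectation_cos 0 0).
  by congr cvg_expectation; apply/funext => y; rewrite big_ord0; ring.
have := cvg_expectation_lin 1 p`_n IH (cvg_expectation_sinX_cos om v n 0 0).
congr cvg_expectation; apply/funext => y.
by rewrite big_ord_recr/= mul0r addr0 cos0 mulr1 mul1r.
Qed.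

(* The approximant is [(1 - s ^ n) ^ (2 ^ n)] with [s = (1 + sin (om (y - x - delta / 2))) / 2]:
   it is a trigonometric polynomial, and [om] is so small that the sine is
   increasing on [[-A, A]]. *)
Lemma cvg_expectation_step (x delta A e : R) : 0 < delta -> 0 <= A -> 0 < e ->
  exists g, [/\ cvg_expectation g, forall y, 0 <= g y <= 1,
    forall y, `|y| <= A -> y <= x -> 1 - e <= g y &
    forall y, `|y| <= A -> x + delta <= y -> g y <= e].
Proof.
move=> d0 A0 e0.
pose x0 := x + delta / 2; pose B := A + `|x0| + delta.
have xB : 0 <= `|x0| by [].
have B0 : 0 < B by rewrite /B; lra.
pose om := pi / 2 / B; have pi0 := pi_gt0 R.
have om0 : 0 < om by rewrite /om !divr_gt0.
have omB y : `|y| <= B -> om * y \in `[(- (pi / 2)), pi / 2]%R.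
  move=> yB; rewrite in_itv/= -ler_norml normrM gtr0_norm//.
  have -> : pi / 2 = om * B by rewrite /om divfK// gt_eqF.
  by rewrite ler_pM2l.
have yB y : `|y| <= A -> `|y - x0| <= B.
  by move=> yA; rewrite (le_trans (ler_normB _ _))// /B; lra.
(* At x and x + delta, the points at distance delta/2 from the midpoint x0, the variable s below
   equals (1 - eta)/2 and (1 + eta)/2, the two thresholds of [step_exists]. *)
pose eta := sin (om * (delta / 2)).
have dB : `|delta / 2| <= B by rewrite ger0_norm /B; lra.
have le_sin y z : `|y| <= B -> `|z| <= B -> y <= z -> sin (om * y) <= sin (om * z).
  move=> yB' zB; rewrite le_eqVlt => /predU1P[->//|yz].
  by apply/ltW; rewrite ltr_sin ?omB// ltr_pM2l.
have eta0 : 0 < eta.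
  have -> : 0 = sin (om * 0 : R) by rewrite mulr0 sin0.
  by rewrite ltr_sin ?omB ?normr0// ?ltr_pM2l//; [lra|exact: ltW].
have eta1 : eta <= 1 := sin_le1 _.
have [n nP] := @step_exists R eta e ltac:(by rewrite eta0) e0.
pose s y := (1 + sin (om * y + - (om * x0))) / 2.
have sE y : s y = (1 + sin (om * (y - x0))) / 2 by rewrite /s mulrBr.
have s01 y : 0 <= s y <= 1.
  by have := sin_le1 (om * (y - x0)); have := sin_geN1 (om * (y - x0)); rewrite sE; lra.
exists (fun y => (1 - s y ^+ n) ^+ (2 ^ n)); split.
- have := cvg_expectation_poly om (- (om * x0)) ((1 - 'X^n) ^+ (2 ^ n)).
  congr cvg_expectation; apply/funext => y.
  by rewrite horner_exp hornerD hornerN hornerC hornerXn.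
- move=> y; have /andP[s0 s1] := s01 y.
  have u1 : s y ^+ n <= 1 by rewrite exprn_ile1.
  have u0 : 0 <= s y ^+ n by rewrite exprn_ge0.
  by rewrite exprn_ge0 ?exprn_ile1//; lra.
- move=> y yA yx; apply: (nP (s y)).1; have /andP[-> _] /= := s01 y; rewrite sE.
  have : sin (om * (y - x0)) <= sin (om * (- (delta / 2))).
    by apply: le_sin; rewrite ?normrN// ?yB// /x0; lra.
  by rewrite mulrN sinN -/eta; lra.
- move=> y yA yx; apply: (nP (s y)).2; have /andP[_ ->] := s01 y; rewrite andbT sE.
  have : sin (om * (delta / 2)) <= sin (om * (y - x0)).
    by apply: le_sin; rewrite ?yB// /x0; lra.
  by rewrite -/eta; lra.
Qed.

Hypothesis tight : forall e : R, 0 < e -> exists A : R, forall n,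
  (P n [set w | A < `|X n w| ]%R <= e%:E)%E.

Let tightY (e : R) : 0 < e -> exists A : R, (Q [set w | A < `|Y w| ]%R <= e%:E)%E.
Proof.
move=> e0; have e20 : 0 < e / 2 by lra.
have := @cvg_cdfNy0 _ _ _ _ Y => /fine_cvgP[_ /cvgrPdist_le/(_ _ e20)[M1 [_ h1]]].
have := @cvg_ccdfy0 _ _ _ _ Y => /fine_cvgP[_ /cvgrPdist_le/(_ _ e20)[M2 [_ h2]]].
pose A : R := Num.max (`|M1| + 1) (`|M2| + 1); exists A.
have A1 : `|M1| + 1 <= A by rewrite le_max lexx.
have A2 : `|M2| + 1 <= A by rewrite le_max lexx orbT.
have c1 : (cdf Y (- A) <= (e / 2)%:E)%E.
  rewrite -(@fineK _ (cdf Y (- A))) ?fin_num_measure// lee_fin.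
  have M1A : - M1 <= `|M1| by rewrite -normrN ler_norm.
  have /= := h1 (- A) ltac:(lra).
  by rewrite sub0r normrN; apply: le_trans; exact: ler_norm.
have c2 : (ccdf Y A <= (e / 2)%:E)%E.
  rewrite -(@fineK _ (ccdf Y A)) ?fin_num_measure// lee_fin.
  have M2A := ler_norm M2.
  have /= := h2 A ltac:(lra).
  by rewrite sub0r normrN; apply: le_trans; exact: ler_norm.
have -> : e = e / 2 + e / 2 by lra.
rewrite EFinD; apply: le_trans (leeD c1 c2).
apply: le_trans (measureU2 _ _ _) => //.
apply: le_measure; rewrite ?inE; first exact: measurable_tail.
  by apply: measurable_funPTI; exact: measurableU.
move=> w /=; rewrite !in_itv/= andbT ltNge ler_norml negb_and -!ltNge.
by case/orP => h; [left; exact: ltW|right].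
Qed.

Let sandwich (x delta e : R) : 0 < delta -> 0 < e ->
  \forall n \near \oo, fine (cdf (X n) x) <= fine (cdf Y (x + delta)) + e /\
    fine (cdf Y x) <= fine (cdf (X n) (x + delta)) + e.
Proof.
(* Two fifths go to each comparison of a cdf with an expectation, one fifth to the difference of the
   two expectations. *)
move=> d0 e0; have e50 : 0 < e / 5 by lra.
have [A1 A1P] := tight e50; have [A2 A2P] := tightY e50.
pose A : R := Num.max 0 (Num.max A1 A2).
have A0 : 0 <= A by rewrite le_max lexx.
have [g [gc g01 glo ghi]] := @cvg_expectation_step x delta A (e / 5) d0 A0 e50.
have [mg _ /cvgrPdist_le/(_ _ e50)] := gc; apply: filterS => n; rewrite ler_norml => hn.
have monoA d1 (T1 : measurableType d1) (P1 : probability T1 R) (Z : {RV P1 >-> R}) (A' : R) :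
    A' <= A -> (P1 [set w | A' < `|Z w| ]%R <= (e / 5)%:E)%E ->
    (P1 [set w | A < `|Z w| ]%R <= (e / 5)%:E)%E.
  move=> AA; apply: le_trans; apply: le_measure; rewrite ?inE.
  - exact: measurable_tail.
  - exact: measurable_tail.
  - by move=> w /=; exact: le_lt_trans.
have t1 : (P n [set w | A < `|X n w| ]%R <= (e / 5)%:E)%E.
  by apply: monoA (A1P n); rewrite !le_max lexx orbT.
have t2 : (Q [set w | A < `|Y w| ]%R <= (e / 5)%:E)%E.
  by apply: monoA A2P; rewrite !le_max lexx !orbT.
have := cdf_le_expectation mg g01 glo (ltW e50) t1.
have := expectation_le_cdf mg g01 ghi (ltW e50) t1.
have := cdf_le_expectation mg g01 glo (ltW e50) t2.
have := expectation_le_cdf mg g01 ghi (ltW e50) t2.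
by rewrite !mulr2n; lra.
Qed.

Theorem cvg_cos_in_distribution : cvg_in_distribution X Y.
Proof.
have cdfK d1 (T1 : measurableType d1) (P1 : probability T1 R) (Z : {RV P1 >-> R}) y :
  (fine (cdf Z y))%:E = cdf Z y by rewrite cdfE.
move=> x cYx.
have /fine_cvgP[_ cY] : cdf Y y @[y --> x] --> (fine (cdf Y x))%:E by rewrite cdfK; exact: cYx.
rewrite -(cdfK _ _ _ Y x); apply/fine_cvgP; split; first by apply: nearW => n; rewrite cdfE.
apply/cvgrPdist_le => e e0; have e20 : 0 < e / 2 by lra.
move/cvgrPdist_le : cY => /(_ _ e20)[delta /= d0 dP].
have d20 : 0 < delta / 2 by rewrite divr_gt0.
have hp : `|fine (cdf Y x) - fine (cdf Y (x + delta / 2))| <= e / 2.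
  by apply: dP; rewrite /= opprD addrA subrr sub0r normrN ger0_norm ?ltW//; lra.
have hm : `|fine (cdf Y x) - fine (cdf Y (x - delta / 2))| <= e / 2.
  by apply: dP; rewrite /= opprB addrC subrK ger0_norm ?ltW//; lra.
near=> n.
have [h1 _] : fine (cdf (X n) x) <= fine (cdf Y (x + delta / 2)) + e / 2 /\
    fine (cdf Y x) <= fine (cdf (X n) (x + delta / 2)) + e / 2.
  by near: n; exact: sandwich.
(* The lower bound starts at x - delta/2 so that the sandwich ends at x. *)
have [_ h2] : fine (cdf (X n) (x - delta / 2)) <= fine (cdf Y (x - delta / 2 + delta / 2)) + e / 2 /\
    fine (cdf Y (x - delta / 2)) <= fine (cdf (X n) (x - delta / 2 + delta / 2)) + e / 2.
  by near: n; exact: sandwich.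
rewrite subrK in h2; move: hp hm; rewrite !ler_norml /=; lra.
Unshelve. all: by end_near. Qed.

End cos_convergence.

(** * Derivatives of affine trigonometric functions and of Gaussians *)

Section calculus.
Variable R : realType.
Local Notation mu := (@lebesgue_measure R).

Lemma is_derive_continuous (f : R -> R) (x df : R) : is_derive x 1 f df -> {for x, continuous f}.
Proof. by move=> h; apply: differentiable_continuous; apply/derivable1_diffP; exact: (@ex_derive _ _ _ _ _ _ _ h). Qed.

Lemma is_derive_affine (t u x : R) : is_derive x 1 (fun y : R => t * y + u) t.
Proof.
have -> : (fun y : R => t * y + u) = horner (t *: 'X + u%:P).
  by apply/funext => y; rewrite hornerD hornerZ hornerX hornerC.
apply: is_derive_eq; rewrite derivD derivZ derivX derivC addr0 hornerZ hornerC.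
by rewrite mulr1.
Qed.

Lemma is_derive_cos_affine (t u x : R) :
  is_derive x 1 (fun y : R => cos (t * y + u)) (- t * sin (t * x + u)).
Proof.
have h := is_derive_affine t u x.
apply: (is_derive_eq (@is_derive1_comp R cos (fun y : R => t * y + u) x _ _ (is_derive_cos _) h)).
by ring.
Qed.

Lemma is_derive_sin_affine (t u x : R) :
  is_derive x 1 (fun y : R => sin (t * y + u)) (t * cos (t * x + u)).
Proof.
have h := is_derive_affine t u x.
apply: (is_derive_eq (@is_derive1_comp R sin (fun y : R => t * y + u) x _ _ (is_derive_sin _) h)).
by rewrite mulrC.
Qed.

Lemma is_derive_expR_sqr (k x : R) :
  is_derive x 1 (fun y : R => expR (k * y ^+ 2)) (2 * k * x * expR (k * x ^+ 2)).
Proof.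
have h : is_derive x 1 (fun y : R => k * y ^+ 2) (2 * k * x).
  have -> : (fun y : R => k * y ^+ 2) = horner (k *: 'X^2).
    by apply/funext => y; rewrite hornerZ hornerXn.
  apply: is_derive_eq; rewrite derivZ derivXn hornerZ hornerMn hornerXn.
  by rewrite /= expr1 mulr2n; ring.
apply: (is_derive_eq (@is_derive1_comp R expR (fun y : R => k * y ^+ 2) x _ _ (is_derive_expR _) h)).
by ring.
Qed.

Lemma integral_FTC (F f : R -> R) (a b : R) : a < b ->
  (forall x : R, is_derive x 1 F (f x)) -> continuous f ->
  (\int[mu]_(x in `[a, b]) (f x)%:E = (F b - F a)%:E)%E.
Proof.
move=> ab dF cf; have cF : continuous F by move=> x; exact: is_derive_continuous (dF x).
rewrite EFinB (@continuous_FTC2 _ f F)//.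
- exact: continuous_subspaceT.
- split.
  + by move=> x _; exact: (@ex_derive _ _ _ _ _ _ _ (dF x)).
  + exact/cvg_at_right_filter/cF.
  + exact/cvg_at_left_filter/cF.
- by move=> x _; rewrite derive1E; exact: (@derive_val _ _ _ _ _ _ _ (dF x)).
Qed.

End calculus.

(** * Cosine expectations of the standard normal law *)

Section normal_cos.
Variable R : realType.
Local Notation mu := (@lebesgue_measure R).
Local Notation phi := (normal_pdf (0 : R) 1).

Lemma std_normal_pdfE (x : R) : phi x = normal_peak 1 * expR (- 2^-1 * x ^+ 2).
Proof.
rewrite normal_pdfE ?oner_eq0// /normal_fun subr0 expr1n.
by congr (_ * expR _); rewrite mulr2n; field.
Qed.

Lemma is_derive_phi (x : R) : is_derive x 1 phi (- x * phi x).
Proof.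
have -> : phi = normal_peak 1 \*: (fun y : R => expR (- 2^-1 * y ^+ 2)).
  by apply/funext => y; rewrite std_normal_pdfE.
have h := is_derive_expR_sqr (- 2^-1) x.
apply: is_derive_eq.
rewrite -[LHS]/(normal_peak 1 * (2 * - 2^-1 * x * expR (- 2^-1 * x ^+ 2))).
rewrite -[X in _ = _ * X]/(normal_peak 1 * expR (- 2^-1 * x ^+ 2)).
by field.
Qed.

Lemma integrable_bounded_phi (f : R -> R) (K : R) : measurable_fun setT f ->
  (forall x, `|f x| <= K) -> mu.-integrable setT (EFin \o (fun x => f x * phi x)).
Proof.
move=> mf fK.
have K0 : 0 <= K by apply: le_trans (fK 0).
have gi : mu.-integrable setT (fun x => K%:E * (phi x)%:E)%E.
  by apply: integrableZl => //; exact: integrable_normal_pdf.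
apply: (le_integrable measurableT _ _ gi).
- apply/measurable_EFinP; apply: measurable_funM => //; exact: measurable_normal_pdf.
- move=> x _ /=; rewrite lee_fin !normrM (ger0_norm K0).
  by apply: ler_wpM2r.
Qed.

(** 3/8 = 1/2 - 1/8 is the gap between the exponents of the normal densities with standard
    deviations 1 and 2. *)
Let norm_le_sqr (x : R) : `|x| <= 1 + 3 / 8 * x ^+ 2.
Proof.
rewrite -[x ^+ 2]real_normK ?num_real//; move: `|x| => z.
by have := sqr_ge0 (z - 4 / 3); nra.
Qed.

(* [|x| exp (- x^2 / 2) <= exp (- x^2 / 8)] reduces the claim to the normal
   density with standard deviation 2. *)
Lemma integrable_norm_phi : mu.-integrable setT (EFin \o (fun x : R => `|x| * phi x)).
Proof.
have [K K0 KE] : exists2 K : R, 0 <= K & K * normal_peak 2 = normal_peak 1.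
  exists (normal_peak 1 / normal_peak 2); first by rewrite divr_ge0 ?normal_peak_ge0.
  by rewrite divfK// gt_eqF// normal_peak_gt0.
have gi : mu.-integrable setT (fun x => K%:E * (normal_pdf 0 2 x)%:E)%E.
  by apply: integrableZl => //; exact: integrable_normal_pdf.
apply: (le_integrable measurableT _ _ gi).
- apply/measurable_EFinP; apply: measurable_funM => //.
  exact: measurable_normal_pdf.
- move=> x _ /=; rewrite lee_fin !normrM normr_id !(ger0_norm (normal_pdf_ge0 _ _ _)) (ger0_norm K0).
  rewrite std_normal_pdfE normal_pdfE// /normal_fun subr0.
  rewrite mulrCA [leRHS]mulrA KE ler_wpM2l ?normal_peak_ge0//.
  have -> : - 2^-1 * x ^+ 2 = - (3 / 8 * x ^+ 2) + - x ^+ 2 / (2 ^+ 2 *+ 2).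
    by rewrite mulr2n; field.
  rewrite expRD mulrA ler_piMl ?expR_ge0// expRN ler_pdivrMr ?expR_gt0// mul1r.
  apply: le_trans (expR_ge1Dx _).
  exact: norm_le_sqr.
Qed.

(** The change of measure goes through the Radon-Nikodym derivative, identified almost everywhere
    with the density by comparing integrals over measurable sets. *)
Lemma Rintegral_normal_prob (f : R -> R) (K : R) : measurable_fun setT f ->
  (forall x, `|f x| <= K) ->
  \int[normal_prob (0 : R) 1]_x f x = \int[mu]_x (f x * phi x).
Proof.
move=> mf fK; congr fine.
have fi : (normal_prob (0 : R) 1).-integrable setT (EFin \o f).
  apply: measurable_bounded_integrable => //.
    by rewrite -ge0_fin_numE// fin_num_measure.
  exists K; split; first exact: num_real.
  by move=> M KM x _; apply: le_trans (fK _) (ltW KM).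
have dom := normal_prob_dominates (0 : R) 1.
rewrite -(Radon_Nikodym_change_of_variables dom measurableT fi).
apply: ae_eq_integral => //.
- apply: emeasurable_funM; first exact/measurable_EFinP.
  by apply: (measurable_int mu); apply: Radon_Nikodym_integrable.
- apply/measurable_EFinP; apply: measurable_funM => //; exact: measurable_normal_pdf.
have : ae_eq mu setT (Radon_Nikodym (charge_of_finite_measure (normal_prob (0 : R) 1)) mu) (EFin \o phi).
  apply: integral_ae_eq => //.
  - exact: Radon_Nikodym_integrable.
  - by apply/measurable_EFinP; exact: measurable_normal_pdf.
  - by move=> E _ mE; rewrite -Radon_Nikodym_integral.
by apply: filterS => x /= /(_ I) -> _; rewrite EFinM.
Qed.

Lemma measurable_sin_affine (t u : R) : measurable_fun setT (fun y : R => sin (t * y + u)).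
Proof.
by apply: continuous_measurable_fun => y; exact: is_derive_continuous (is_derive_sin_affine t u y).
Qed.

Lemma integrable_cos_phi (t u : R) :
  mu.-integrable setT (EFin \o (fun x => cos (t * x + u) * phi x)).
Proof.
apply: (@integrable_bounded_phi _ 1); first exact: measurable_cos_affine.
by move=> x; exact: cos_max.
Qed.

Lemma integrable_sin_phi (t u : R) :
  mu.-integrable setT (EFin \o (fun x => x * sin (t * x + u) * phi x)).
Proof.
apply: (le_integrable measurableT _ _ integrable_norm_phi).
  apply/measurable_EFinP; apply: measurable_funM; last exact: measurable_normal_pdf.
  by apply: measurable_funM => //; exact: measurable_sin_affine.
move=> x _ /=; rewrite lee_fin !normrM normr_id ler_wpM2r// ler_piMr//.
exact: sin_max.
Qed.

(** The derivative in x of sin(t x + u) phi(x), see [is_derive_H]. *)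
Let h (t u x : R) := t * (cos (t * x + u) * phi x) - x * sin (t * x + u) * phi x.

Let ih t u : mu.-integrable setT (EFin \o h t u).
Proof.
apply: integrable_subr; last exact: integrable_sin_phi.
by apply: integrable_mulrl; exact: integrable_cos_phi.
Qed.

Let continuous_phi : continuous phi.
Proof. by apply: continuous_normal_pdf; exact: oner_neq0. Qed.

Let continuous_h t u : continuous (h t u).
Proof.
move=> x; have cc := is_derive_continuous (is_derive_cos_affine t u x).
have cs := is_derive_continuous (is_derive_sin_affine t u x).
apply: cvgB; first by apply: cvgMr; apply: cvgM => //; exact: continuous_phi.
by apply: cvgM; [apply: cvgM => //; exact: cvg_id|exact: continuous_phi].
Qed.

Let is_derive_H t u (x : R) : is_derive x 1 (fun y => sin (t * y + u) * phi y) (h t u x).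
Proof.
have h1 := is_derive_sin_affine t u x; have h2 := is_derive_phi x.
apply: (is_derive_eq (is_deriveM h1 h2)).
by rewrite /h /GRing.scale/=; ring.
Qed.

Let phi_harmonic n : `|phi n.+1%:R| <= normal_peak 1 * 2 * harmonic n /\
  `|phi (- n.+1%:R)| <= normal_peak 1 * 2 * harmonic n.
Proof.
have pE : phi (- n.+1%:R) = phi n.+1%:R by rewrite !std_normal_pdfE sqrrN.
suff H : `|phi n.+1%:R| <= normal_peak 1 * 2 * harmonic n by rewrite pE.
rewrite ger0_norm ?normal_pdf_ge0// std_normal_pdfE -mulrA.
apply: ler_wpM2l; first exact: normal_peak_ge0.
rewrite mulNr expRN /harmonic/= ler_pdivlMr ?ltr0n// mulrC ler_pdivrMr ?expR_gt0//.
have := expR_ge1Dx (2^-1 * n.+1%:R ^+ 2 : R).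
have : 1 <= n.+1%:R :> R by rewrite ler1n.
by move: (n.+1%:R : R) (expR _) => z w; nra.
Qed.

(** On [D n] the fundamental theorem leaves only boundary terms, killed by the decay in
    [phi_harmonic]; dominated convergence, with |h| as the bound, passes to the whole line. *)
Lemma normal_by_parts t u : \int[mu]_x h t u x = 0.
Proof.
pose D n : set R := `[(- n.+1%:R), n.+1%:R]%classic.
have cvgI : \int[mu]_(x in D n) h t u x @[n --> \oo] --> \int[mu]_x h t u x.
  have mh : measurable_fun setT (EFin \o h t u) by have /integrableP[] := ih t u.
  have [|||||_ _] := @dominated_convergence _ _ _ mu setT measurableT
     (fun n => EFin \o ((h t u) \_ (D n))) (EFin \o h t u) (abse \o (EFin \o h t u)).
  - move=> n; apply/measurable_EFinP; apply/(measurable_restrictT _ _).1; first exact: measurable_itv.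
    by apply: measurable_funTS; exact/measurable_EFinP.
  - exact: mh.
  - apply: aeW => x _; apply: cvg_near_cst; near=> n; rewrite /= patchE mem_set//.
    rewrite /D/= in_itv/= -ler_norml ltW//; near: n.
    by exists (Num.bound `|x|) => // m /= xm; rewrite (lt_le_trans (archi_boundP _))// ler_nat leqW.
  - exact: integrable_abse.
  - apply: aeW => x n _ /=; rewrite patchE; case: ifP => // _.
    by rewrite lee_fin (_ : point = 0 :> R)// normr0.
  rewrite -[X in _ --> X -> _]fineK; last exact: (integrable_fin_num measurableT (ih t u)).
  by move/fine_cvg; under [X in _ -> X]eq_cvg do rewrite Rintegral_mkcond.
have cvg0 : \int[mu]_(x in D n) h t u x @[n --> \oo] --> (0 : R).
  have E n : \int[mu]_(x in D n) h t u x = sin (t * n.+1%:R + u) * phi n.+1%:R -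
      sin (t * - n.+1%:R + u) * phi (- n.+1%:R).
    have lt0 : - n.+1%:R < n.+1%:R :> R by rewrite gtrN// ltr0n.
    by rewrite /Rintegral (integral_FTC lt0 (is_derive_H t u) (@continuous_h t u)).
  under eq_cvg do rewrite E.
  apply: norm_cvg0; apply: (@squeeze_cvgr _ _ _ _ (cst 0) (fun n => normal_peak 1 * 4 * harmonic n)).
  - apply: nearW => n; rewrite normr_ge0/=; have [h1 h2] := phi_harmonic n.
    apply: le_trans (ler_normB _ _) _; rewrite !normrM.
    have -> : normal_peak 1 * 4 * harmonic n =
       1 * (normal_peak 1 * 2 * harmonic n) + 1 * (normal_peak 1 * 2 * harmonic n) :> R by ring.
    by apply: lerD; apply: ler_pM => //; exact: sin_max.
  - exact: cvg_cst.
  - rewrite -[X in _ --> X](mulr0 (normal_peak 1 * 4)); apply: cvgMr; exact: cvg_harmonic.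
exact: cvg_unique cvgI cvg0.
Unshelve. all: by end_near. Qed.

(** Differentiating under the integral, with |x| phi(x) as dominating function, and integrating by
    parts give J'(s) = - s J(s); so J(s) exp(s^2/2) is constant. *)
Lemma normal_cosE (t u : R) :
  \int[normal_prob (0 : R) 1]_x cos (t * x + u) = cos u * expR (- 2^-1 * t ^+ 2).
Proof.
rewrite (@Rintegral_normal_prob _ 1); [|exact: measurable_cos_affine|by move=> x; exact: cos_max].
pose J (s : R) := \int[mu]_x (cos (s * x + u) * phi x).
have dJ (s : R) : is_derive s 1 J (- s * J s).
  have dp (r x : R) : is_derive r 1 (fun r : R => cos (r * x + u) * phi x) (- (x * sin (r * x + u) * phi x)).
    rewrite (_ : (fun r : R => _) = phi x \*: (fun r : R => cos (x * r + u))); last first.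
      by apply/funext => z; rewrite mulrC [z * x]mulrC.
    have h1 := is_derive_cos_affine x u r.
    apply: (is_derive_eq (is_deriveZ (phi x) h1)).
    by rewrite /GRing.scale/= [r * x]mulrC; ring.
  have pE (r x : R) : partial1of2 (fun r x => cos (r * x + u) * phi x) r x = - (x * sin (r * x + u) * phi x).
    by rewrite partial1of2E; exact: (@derive_val _ _ _ _ _ _ _ (dp r x)).
  have Is : `](s - 1), (s + 1)[%classic s by rewrite /= in_itv/=; lra.
  have H1 (x : R) : `](s - 1), (s + 1)[%classic x ->
     mu.-integrable setT (EFin \o (fun y => cos (x * y + u) * phi y)).
    by move=> _; exact: integrable_cos_phi.
  have H2 (x y : R) : `](s - 1), (s + 1)[%classic x -> setT y ->
     derivable (fun r : R => cos (r * y + u) * phi y) x 1.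
    by move=> _ _; exact: (@ex_derive _ _ _ _ _ _ _ (dp x y)).
  have H3 (y : R) : 0 <= `|y| * phi y by rewrite mulr_ge0// normal_pdf_ge0.
  have H4 (x y : R) : `](s - 1), (s + 1)[%classic x -> setT y ->
     `|partial1of2 (fun r x => cos (r * x + u) * phi x) x y| <= `|y| * phi y.
    move=> _ _; rewrite pE normrN !normrM (ger0_norm (normal_pdf_ge0 _ _ _)).
    by rewrite ler_wpM2r ?normal_pdf_ge0// ler_piMr// sin_max.
  apply: DeriveDef.
    exact: (@derivable_under_integral _ _ _ mu (fun r x => cos (r * x + u) * phi x) _ measurableT
       s (s - 1) (s + 1) Is H1 H2 _ H3 integrable_norm_phi H4).
  rewrite -derive1E.
  rewrite (@differentiation_under_integral _ _ _ mu (fun r x => cos (r * x + u) * phi x) _ measurableT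
       s (s - 1) (s + 1) Is H1 H2 _ H3 integrable_norm_phi H4).
  have := normal_by_parts s u; rewrite /h RintegralB//; last 2 first.
  - by apply: integrable_mulrl; exact: integrable_cos_phi.
  - exact: integrable_sin_phi.
  rewrite RintegralZl//; last exact: integrable_cos_phi.
  move/eqP; rewrite subr_eq0 => /eqP sJ; rewrite mulNr sJ.
  rewrite -mulN1r -RintegralZl//; last exact: integrable_sin_phi.
  by apply: eq_Rintegral => x _; rewrite pE mulN1r.
pose V (s : R) := J s * expR (2^-1 * s ^+ 2).
have dV (s : R) : is_derive s 1 V 0.
  have h1 := dJ s; have h2 := is_derive_expR_sqr (2^-1) s.
  apply: (is_derive_eq (is_deriveM h1 h2)).
  by rewrite /GRing.scale/=; field.
have := is_derive_0_is_cst t 0 dV; rewrite /V expr0n mulr0 expR0 mulr1 => /(canRL (mulfK _)).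
rewrite gt_eqF ?expR_gt0// -/(J t) => -> //; rewrite mulNr expRN; congr (_ / _).
rewrite /J; under eq_Rintegral do rewrite mul0r add0r.
rewrite RintegralZl//; last exact: integrable_normal_pdf.
by rewrite /Rintegral integral_normal_pdf mulr1.
Qed.

End normal_cos.

(** * Taylor bounds for the cardinal sine *)

Section sinc_bounds.
Variable R : realType.

Let is_derive_trig_poly (p : {poly R}) (k l x : R) :
  is_derive x 1 (fun y => p.[y] + (k * sin y + l * cos y)) (p^`().[x] + (k * cos x - l * sin x)).
Proof.
have h1 := is_derive_poly p x.
have h2 := is_deriveZ k (is_derive_sin x); have h3 := is_deriveZ l (is_derive_cos x).
apply: (is_derive_eq (is_deriveD h1 (is_deriveD h2 h3))).
by rewrite -[l *: _]/(l * - sin x) -[k *: _]/(k * cos x); ring.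
Qed.

Let nonneg_of_derive (F f : R -> R) : (forall x : R, is_derive x 1 F (f x)) -> F 0 = 0 ->
  (forall x, 0 <= x -> 0 <= f x) -> forall x, 0 <= x -> 0 <= F x.
Proof.
move=> dF F0 f0 x x0.
have cF : {within `[0, x], continuous F}.
  by apply: continuous_subspaceT => y; exact: is_derive_continuous (dF y).
have [y] := @MVT_segment _ F f 0 x x0 (fun y _ => dF y) cF.
rewrite in_itv/= F0 !subr0 => /andP[y0 _] ->.
by rewrite mulr_ge0 ?f0.
Qed.

(** A single template for a ladder of Taylor bounds: starting from |cos| <= 1, each bound below is
    the derivative condition of the next. *)
Let quintic_ge0 (c0 c1 c2 c3 c4 c5 k l : R) : c0 + l = 0 ->
  (forall x : R, 0 <= x -> 0 <= c1 + 2 * c2 * x + 3 * c3 * x ^+ 2 + 4 * c4 * x ^+ 3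
     + 5 * c5 * x ^+ 4 + (k * cos x - l * sin x)) ->
  forall x : R, 0 <= x -> 0 <= c0 + c1 * x + c2 * x ^+ 2 + c3 * x ^+ 3 + c4 * x ^+ 4
     + c5 * x ^+ 5 + (k * sin x + l * cos x).
Proof.
move=> cl h x x0.
pose p : {poly R} := c0%:P + c1 *: 'X + c2 *: 'X^2 + c3 *: 'X^3 + c4 *: 'X^4 + c5 *: 'X^5.
have pE y : p.[y] = c0 + c1 * y + c2 * y ^+ 2 + c3 * y ^+ 3 + c4 * y ^+ 4 + c5 * y ^+ 5.
  by rewrite !hornerD !hornerZ !hornerXn hornerX hornerC.
have dE y : p^`().[y] = c1 + 2 * c2 * y + 3 * c3 * y ^+ 2 + 4 * c4 * y ^+ 3 + 5 * c5 * y ^+ 4.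
  rewrite !derivD !derivZ !derivXn derivX derivC !hornerD !hornerZ !hornerMn !hornerXn.
  by rewrite horner0 hornerC /=; ring.
rewrite -pE; apply: (nonneg_of_derive (is_derive_trig_poly p k l)) => //.
  by rewrite sin0 cos0 pE; transitivity (c0 + l) => //; ring.
by move=> y y0; rewrite dE; exact: h.
Qed.

Let sin_geN (x : R) : 0 <= x -> - x <= sin x.
Proof.
have h := @quintic_ge0 0 1 0 0 0 0 1 0 (addr0 _).
move=> x0; have := h _ x x0; rewrite !mul0r => H.
suff : 0 <= 0 + 1 * x + 0 + 0 + 0 + 0 + (1 * sin x + 0) by lra.
by apply: H => y _; have := cos_geN1 y; lra.
Qed.

Let sin_le (x : R) : 0 <= x -> sin x <= x.
Proof.
have h := @quintic_ge0 0 1 0 0 0 0 (-1) 0 (addr0 _).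
move=> x0; have := h _ x x0; rewrite !mul0r => H.
suff : 0 <= 0 + 1 * x + 0 + 0 + 0 + 0 + (-1 * sin x + 0) by lra.
by apply: H => y _; have := cos_le1 y; lra.
Qed.

Let cos_ge (x : R) : 0 <= x -> 1 - x ^+ 2 / 2 <= cos x.
Proof.
move=> x0; have := @quintic_ge0 (-1) 0 (2^-1) 0 0 0 0 1 (addNr _) _ x x0.
rewrite !mul0r => H.
suff : 0 <= -1 + 0 + 2^-1 * x ^+ 2 + 0 + 0 + 0 + (0 + 1 * cos x) by lra.
by apply: H => y /sin_le; lra.
Qed.

Let sin_ge3 (x : R) : 0 <= x -> x - x ^+ 3 / 6 <= sin x.
Proof.
move=> x0; have := @quintic_ge0 0 (-1) 0 (6^-1) 0 0 1 0 (addr0 _) _ x x0.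
rewrite !mul0r => H.
suff : 0 <= 0 + -1 * x + 0 + 6^-1 * x ^+ 3 + 0 + 0 + (1 * sin x + 0) by lra.
by apply: H => y /cos_ge; lra.
Qed.

Let cos_le4 (x : R) : 0 <= x -> cos x <= 1 - x ^+ 2 / 2 + x ^+ 4 / 24.
Proof.
move=> x0; have := @quintic_ge0 1 0 (- 2^-1) 0 (24^-1) 0 0 (-1) (subrr _) _ x x0.
rewrite !mul0r => H.
suff : 0 <= 1 + 0 + - 2^-1 * x ^+ 2 + 0 + 24^-1 * x ^+ 4 + 0 + (0 + -1 * cos x) by lra.
by apply: H => y /sin_ge3; lra.
Qed.

Let sin_le5 (x : R) : 0 <= x -> sin x <= x - x ^+ 3 / 6 + x ^+ 5 / 120.
Proof.
move=> x0; have := @quintic_ge0 0 1 0 (- 6^-1) 0 (120^-1) (-1) 0 (addr0 _) _ x x0.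
rewrite !mul0r => H.
suff : 0 <= 0 + 1 * x + 0 + - 6^-1 * x ^+ 3 + 0 + 120^-1 * x ^+ 5 + (-1 * sin x + 0) by lra.
by apply: H => y /cos_le4; lra.
Qed.

Lemma sincN (x : R) : sinc (- x) = sinc x.
Proof. by rewrite /sinc oppr_eq0 sinN invrN mulrNN. Qed.

Lemma sinc_bounds (x : R) :
  `|sinc x| <= 1 /\ 1 - x ^+ 2 / 6 <= sinc x <= 1 - x ^+ 2 / 6 + x ^+ 4 / 120.
Proof.
wlog x0 : x / 0 <= x.
  move=> H; case: (leP 0 x) => [/H//|/ltW x0].
  have := H (- x); rewrite oppr_ge0 sincN => /(_ x0).
  by rewrite sqrrN (_ : (- x) ^+ 4 = x ^+ 4)//; ring.
have [->|xn0] := eqVneq x 0.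
  by rewrite /sinc eqxx normr1 !expr0n/= !mul0r subr0 addr0 lexx.
have {}x0 : 0 < x by rewrite lt0r xn0.
have x0' := ltW x0.
rewrite /sinc (negbTE xn0); split.
  rewrite ler_norml ler_pdivrMr// ler_pdivlMr// mul1r mulN1r.
  by rewrite sin_le// sin_geN.
rewrite ler_pdivrMr// ler_pdivlMr//; apply/andP; split.
  by have := sin_ge3 x0'; apply: le_trans; rewrite le_eqVlt; apply/orP; left; apply/eqP; ring.
by apply: (le_trans (sin_le5 x0')); rewrite le_eqVlt; apply/orP; left; apply/eqP; ring.
Qed.

Lemma norm_sinc_le1 (x : R) : `|sinc x| <= 1.
Proof. exact: (sinc_bounds x).1. Qed.

(** With y = x^2/6, both functions lie between 1 - y and 1 - y + y^2, and y^2 <= x^4. *)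
Lemma sinc_expR (x : R) : `|sinc x - expR (- (x ^+ 2 / 6))| <= x ^+ 4.
Proof.
have [_ /andP[h1 h2]] := sinc_bounds x.
have y0 : 0 <= x ^+ 2 / 6 by rewrite divr_ge0 ?sqr_ge0.
have e1 := expR_ge1Dx (- (x ^+ 2 / 6)).
have e2 : expR (- (x ^+ 2 / 6)) * (1 + x ^+ 2 / 6) <= 1.
  by rewrite expRN mulrC ler_pdivrMr ?expR_gt0// mul1r; exact: expR_ge1Dx.
have E0 := expR_gt0 (- (x ^+ 2 / 6)).
have x4 : x ^+ 4 = 36 * (x ^+ 2 / 6) ^+ 2 by field.
rewrite x4 in h2 *.
move: (x ^+ 2 / 6) (expR _) (sinc x) y0 e1 e2 E0 h1 h2 => y E s y0 e1 e2 E0 h1 h2.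
have e3 : E <= 1 - y + y ^+ 2.
  have y1 : 0 < 1 + y by lra.
  by rewrite -(ler_pM2r y1); nra.
have := sqr_ge0 y; rewrite ler_norml; lra.
Qed.

Lemma continuous_sinc : continuous (@sinc R).
Proof.
move=> x; have [->|x0] := eqVneq x 0.
  apply/cvgrPdist_le => e e0; exists (Num.min 1 e); first by rewrite /= lt_min ltr01.
  move=> y /=; rewrite sub0r normrN lt_min => /andP[y1 ye].
  have [_ /andP[h1 h2]] := sinc_bounds y; have [h3 _] := sinc_bounds y.
  rewrite {1}/sinc eqxx; move: h3; rewrite ler_norml => /andP[_ h3].
  have yy : y ^+ 2 <= `|y|.
    by rewrite -real_normK ?num_real// expr2 ler_piMl// ltW.
  rewrite ger0_norm ?subr_ge0//; apply: le_trans (ltW ye).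
  by have := sqr_ge0 y; lra.
have c : {for x, continuous (fun y : R => sin y / y)}.
  apply: cvgM; first exact: continuous_sin.
  by apply: cvgV => //; exact: cvg_id.
have e : \forall y \near x, sin y / y = sinc y.
  have : \forall y \near x, y != 0.
    exists `|x|; first by rewrite /= normr_gt0.
    by move=> y /=; apply: contraTneq => ->; rewrite subr0 ltxx.
  by apply: filterS => y y0; rewrite /sinc (negbTE y0).
rewrite /continuous_at (_ : sinc x = sin x / x); last by rewrite /sinc (negbTE x0).
by apply: cvg_trans c; apply: near_eq_cvg.
Qed.

End sinc_bounds.

(** * Positivity and continuity of the normal distribution function *)

Section std_normal_cdf.
Variable R : realType.
Local Notation mu := (@lebesgue_measure R).
Local Notation N01 := (normal_prob (0 : R) 1).

Lemma cdf_std_normalE (x : R) : cdf (std_normal_rv R) x = N01 `]-oo, x].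
Proof. by []. Qed.

(** The density is at least [m] on [x - 1, x]. Positivity is what a bounded median contradicts in
    [normal_cvg_median]. *)
Lemma cdf_std_normal_gt0 (x : R) : (0 < cdf (std_normal_rv R) x)%E.
Proof.
rewrite cdf_std_normalE.
pose m := normal_peak 1 * expR (- 2^-1 * (`|x| + 1) ^+ 2) : R.
have m0 : 0 < m by rewrite mulr_gt0 ?expR_gt0// normal_peak_gt0// oner_neq0.
apply: (@lt_le_trans _ _ (N01 `[x - 1, x])); last first.
  apply: le_measure; [rewrite inE; exact: measurable_itv..|].
  by move=> y /=; rewrite !in_itv/= => /andP[].
apply: (@lt_le_trans _ _ (\int[mu]_(y in `[(x - 1)%R, x]) m%:E)%E).
  rewrite integral_cst//= lebesgue_measure_itv/= lte_fin ltrBlDr ltrDl ltr01.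
  by rewrite -EFinB -EFinM lte_fin mulr_gt0//; lra.
rewrite /normal_prob; apply: ge0_le_integral => //=.
- by move=> y _; rewrite lee_fin ltW.
- apply: measurable_funTS; apply/measurable_EFinP; exact: measurable_normal_pdf.
- move=> y; rewrite /= in_itv/= => /andP[xy yx].
  rewrite lee_fin std_normal_pdfE /m ler_wpM2l ?normal_peak_ge0// ler_expR.
  rewrite !mulNr lerN2 ler_wpM2l// -[y ^+ 2]real_normK ?num_real//.
  rewrite lerXn2r ?nnegrE ?addr_ge0//.
  rewrite ler_norml; apply/andP; split.
    by have := lerNnormlW (lexx `|x|); lra.
  by have := ler_norm x; lra.
Qed.

Lemma cdf_std_normal_lipschitz (x y : R) : x <= y ->
  fine (cdf (std_normal_rv R) y) <= fine (cdf (std_normal_rv R) x) + normal_peak 1 * (y - x).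
Proof.
move=> xy; rewrite -lee_fin EFinD !fineK ?fin_num_measure// !cdf_std_normalE.
apply: (@le_trans _ _ (N01 (`]-oo, x] `|` `]x, y]))).
  apply: le_measure; [rewrite inE; exact: measurable_itv| |].
    by rewrite inE; apply: measurableU; exact: measurable_itv.
  move=> z /=; rewrite !in_itv/= => zy; have [zx|xz] := leP z x; first by left.
  by right; rewrite zy.
apply: le_trans (measureU2 _ _ _) _; [exact: measurable_itv|exact: measurable_itv|].
apply: leeD => //; rewrite /= /normal_prob.
apply: (@le_trans _ _ (\int[mu]_(z in `]x, y]) (normal_peak 1)%:E)%E).
  apply: ge0_le_integral => //=.
  - by move=> z _; rewrite lee_fin normal_pdf_ge0.
  - apply: measurable_funTS; apply/measurable_EFinP; exact: measurable_normal_pdf.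
  - by move=> z _; rewrite lee_fin normal_pdf_ub// oner_neq0.
rewrite integral_cst//= lebesgue_measure_itv/= lte_fin.
move: xy; rewrite le_eqVlt => /predU1P[->|xy]; first by rewrite ltxx mule0 subrr mulr0.
by rewrite xy -EFinB -EFinM.
Qed.

(** [cvg_in_distribution] only speaks at continuity points of the limit; this makes every point
    available. *)
Lemma continuous_cdf_std_normal : continuous (cdf (std_normal_rv R)).
Proof.
move=> x; have K y : (fine (cdf (std_normal_rv R) y))%:E = cdf (std_normal_rv R) y.
  by rewrite fineK// fin_num_measure.
rewrite /continuous_at -K; apply/fine_cvgP; split.
  by apply: nearW => y; rewrite -K.
apply/cvgrPdist_le => e e0.
have p0 : 0 < normal_peak (1 : R) by exact: normal_peak_gt0 (oner_neq0 _).
exists (e / normal_peak 1); first by rewrite /= divr_gt0.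
move=> y /=; rewrite ltr_pdivlMr// mulrC => /ltW xye; apply: le_trans xye.
have nd := @cdf_nondecreasing _ _ _ _ (std_normal_rv R).
rewrite ler_norml; case: (leP x y) => [xy|/ltW yx].
  have h1 := cdf_std_normal_lipschitz xy.
  have h2 : fine (cdf (std_normal_rv R) x) <= fine (cdf (std_normal_rv R) y).
    by rewrite -lee_fin !K nd.
  by rewrite distrC ger0_norm ?subr_ge0//; lra.
have h1 := cdf_std_normal_lipschitz yx.
have h2 : fine (cdf (std_normal_rv R) y) <= fine (cdf (std_normal_rv R) x).
  by rewrite -lee_fin !K nd.
by rewrite ger0_norm ?subr_ge0//; lra.
Qed.

End std_normal_cdf.

(** * Moments and cosine expectations of the Irwin-Hall law *)

Section irwin_hall_law.
Variable R : realType.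
Local Notation mu := (@lebesgue_measure R).
Local Notation U := (uniform_prob (@ltr01 R)).

Lemma tuple_sum_cons n (x : R) (t : n.-tuple (measurableTypeR R)) :
  tuple_sum (Defs.cons_tuple ((x : measurableTypeR R), t)) = x + tuple_sum t.
Proof. by rewrite /tuple_sum big_ord_recl; congr (_ + _); apply: eq_bigr => i _; rewrite tnthS. Qed.

Lemma integral_irwin_hall0 (f : R -> R) : measurable_fun setT f ->
  (\int[uniform01_power R 0]_t (f (tuple_sum t))%:E = (f 0)%:E)%E.
Proof.
move=> mf; rewrite integral_dirac//; last first.
  by apply/measurable_EFinP; exact: measurableT_comp.
by rewrite diracT mul1e /tuple_sum big_ord0.
Qed.

Lemma integral_irwin_hallS n (f : R -> R) : measurable_fun setT f -> (forall x, 0 <= f x) ->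
  (\int[uniform01_power R n.+1]_t (f (tuple_sum t))%:E =
   \int[U]_x \int[uniform01_power R n]_t (f (x + tuple_sum t))%:E)%E.
Proof.
move=> mf f0; rewrite ge0_integral_distribution//; last 2 first.
  by apply/measurable_EFinP; exact: measurableT_comp.
  by move=> t; rewrite lee_fin.
pose g (z : measurableTypeR R * n.-tuple (measurableTypeR R)) : \bar R :=
  (f (tuple_sum (Defs.cons_tuple z)))%:E.
have mg : measurable_fun setT g.
  apply/measurable_EFinP; apply: measurableT_comp => //.
  apply: measurableT_comp; exact: measurable_funPT.
have g0 z : (0 <= g z)%E by rewrite lee_fin.
transitivity (\int[U]_x \int[uniform01_power R n]_t g (x, t))%E.
  exact: (@fubini_tonelli1 _ _ _ _ R U (uniform01_power R n) g mg g0).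
by apply: eq_integral => x _; apply: eq_integral => t _; rewrite /g tuple_sum_cons.
Qed.

Lemma integral_uniform01 (f : R -> R) : continuous f -> (forall x, 0 <= f x) ->
  (\int[U]_x (f x)%:E = \int[mu]_(x in `[0%R, 1%R]) (f x)%:E)%E.
Proof.
move=> cf f0; rewrite integral_uniform//.
- by rewrite subr0 invr1 mul1e.
- by apply/measurable_EFinP; exact: continuous_measurable_fun.
Qed.

Lemma integral_cos01 (t v k : R) :
  (\int[mu]_(x in `[0%R, 1%R]) (1 + k * cos (t * x + v))%:E =
   (1 + k * (sinc (t / 2) * cos (t / 2 + v)))%:E)%E.
Proof.
pose F x := x + k * (if t == 0 then x * cos v else sin (t * x + v) / t).
have dF (x : R) : is_derive x 1 F (1 + k * cos (t * x + v)).
  rewrite /F; case: eqP => [->|/eqP t0].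
    have h := is_derive_affine (1 + k * cos v) 0 x.
    rewrite (_ : (fun x : R => _) = (fun y : R => (1 + k * cos v) * y + 0)); last first.
      by apply/funext => y; ring.
    by apply: (is_derive_eq h); rewrite mul0r add0r.
  have h1 := is_derive_affine 1 0 x.
  have h2 := is_deriveZ (k / t) (is_derive_sin_affine t v x).
  rewrite (_ : (fun x : R => _) = (fun y : R => 1 * y + 0) + (k / t) \*: (fun y : R => sin (t * y + v))); last first.
    apply/funext => y; rewrite -[RHS]/(1 * y + 0 + k / t * sin (t * y + v)).
    by field.
  apply: (is_derive_eq (is_deriveD h1 h2)).
  by rewrite -[_ *: _]/(k / t * (t * cos (t * x + v))); field.
have cf : continuous (fun x : R => 1 + k * cos (t * x + v)).
  move=> x; apply: cvgD; first exact: cvg_cst.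
  by apply: cvgMr; exact: is_derive_continuous (is_derive_cos_affine t v x).
rewrite (integral_FTC ltr01 dF cf); congr (_%:E); rewrite /F /sinc.
have [->|t0] := eqVneq t 0; first by rewrite !mul0r eqxx !add0r; ring.
rewrite [_ / 2 == 0]mulf_eq0 (negbTE t0) invr_eq0 pnatr_eq0/= mulr1 mulr0 !add0r.
have e1 : sin (t + v) = sin (t / 2) * cos (t / 2 + v) + cos (t / 2) * sin (t / 2 + v).
  by rewrite -sinD; congr sin; field.
have e2 : sin v = sin (t / 2 + v) * cos (t / 2) - cos (t / 2 + v) * sin (t / 2).
  by rewrite -sinB; congr sin; ring.
by rewrite e1 e2; field.
Qed.

Lemma integral_sqr01 (w k : R) :
  (\int[mu]_(x in `[0%R, 1%R]) ((w + x) ^+ 2 + k)%:E =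
   ((w + 2^-1) ^+ 2 + (k + 12^-1))%:E)%E.
Proof.
pose p : {poly R} := 3^-1 *: 'X^3 + w *: 'X^2 + (w ^+ 2 + k) *: 'X.
have pE x : p.[x] = 3^-1 * x ^+ 3 + w * x ^+ 2 + (w ^+ 2 + k) * x.
  by rewrite !hornerD !hornerZ !hornerXn hornerX.
have dp x : p^`().[x] = (w + x) ^+ 2 + k.
  rewrite !derivD !derivZ !derivXn derivX !hornerD !hornerZ !hornerMn !hornerXn hornerC.
  by rewrite /=; field.
have dF (x : R) : is_derive x 1 (horner p) ((w + x) ^+ 2 + k).
  by rewrite -dp; exact: is_derive_poly.
have cf : continuous (fun x : R => (w + x) ^+ 2 + k).
  rewrite (_ : (fun x => _) = horner (p^`())); first exact: continuous_horner.
  by apply/funext => x; rewrite dp.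
by rewrite (integral_FTC ltr01 dF cf) !pE; congr (_%:E); field.
Qed.

(** The summand 1 makes the integrand nonnegative, as Tonelli in [integral_irwin_hallS] requires.
    Each coordinate contributes a factor sinc(t/2) and a phase t/2. *)
Lemma integral_irwin_hall_cos (t : R) n (u : R) :
  (\int[uniform01_power R n]_s (1 + cos (t * tuple_sum s + u))%:E =
   (1 + sinc (t / 2) ^+ n * cos (t / 2 *+ n + u))%:E)%E.
Proof.
have mf v : measurable_fun setT (fun y : R => 1 + cos (t * y + v)).
  by apply: measurable_funD => //; exact: measurable_cos_affine.
have f0 v x : 0 <= 1 + cos (t * x + v) by have := cos_geN1 (t * x + v); lra.
elim: n u => [|n IH] u.
  by rewrite (integral_irwin_hall0 (mf u)) mulr0 mulr0n expr0 mul1r.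
rewrite (integral_irwin_hallS _ (mf u) (f0 u)).
under eq_integral => x _.
  under eq_integral => s _ do rewrite mulrDr -addrA addrCA.
  rewrite IH addrCA; over.
rewrite (@integral_uniform01 (fun x => 1 + sinc (t / 2) ^+ n * cos (t * x + (t / 2 *+ n + u)))).
- rewrite integral_cos01 exprSr -mulrA; congr (1 + _ * (_ * cos _))%:E.
  by rewrite (mulrS (t / 2)) addrA.
- move=> x; apply: cvgD; first exact: cvg_cst.
  by apply: cvgMr; exact: is_derive_continuous (is_derive_cos_affine t _ x).
- move=> x; have h : `|sinc (t / 2) ^+ n * cos (t * x + (t / 2 *+ n + u))| <= 1.
    rewrite normrM mulr_ile1// ?cos_max// normrX exprn_ile1//.
    exact: norm_sinc_le1.
  by move: h; rewrite ler_norml; lra.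
Qed.

(** The shift [v] absorbs the first coordinate in the induction. Afterwards v = 0 and v = 1 give the
    mean by polarization, and v = -M/2 gives the variance. *)
Lemma integral_irwin_hall_sqr n (v : R) :
  (\int[uniform01_power R n]_s ((tuple_sum s + v) ^+ 2)%:E =
   ((n%:R / 2 + v) ^+ 2 + n%:R / 12)%:E)%E.
Proof.
have cf w k : continuous (fun y : R => (w + y) ^+ 2 + k).
  rewrite (_ : (fun x => _) = horner ((w%:P + 'X) ^+ 2 + k%:P)); first exact: continuous_horner.
  by apply/funext => x; rewrite hornerD horner_exp hornerD !hornerC hornerX.
have mf w : measurable_fun setT (fun y : R => (y + w) ^+ 2).
  apply: continuous_measurable_fun; rewrite (_ : (fun y => _) = (fun y => (w + y) ^+ 2 + 0)); first exact: cf.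
  by apply/funext => y; rewrite addr0 addrC.
have f0 w (y : R) : 0 <= (y + w) ^+ 2 by rewrite sqr_ge0.
elim: n v => [|n IH] v.
  by rewrite (integral_irwin_hall0 (mf v)) !mul0r addr0.
rewrite (integral_irwin_hallS _ (mf v) (f0 v)).
under eq_integral => x _.
  under eq_integral => s _ do rewrite addrAC addrC addrA.
  under eq_integral => s _ do rewrite -addrA.
  rewrite IH.
  rewrite (_ : n%:R / 2 + (x + v) = n%:R / 2 + v + x); last by rewrite addrA addrAC.
  over.
rewrite (@integral_uniform01 (fun x => (n%:R / 2 + v + x) ^+ 2 + n%:R / 12)).
- by rewrite integral_sqr01; congr (_%:E); rewrite -natr1; field.
- exact: cf.
- by move=> x; rewrite addr_ge0 ?sqr_ge0// divr_ge0.
Qed.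

Variable M : nat.
Local Notation P := (uniform01_power R M).
Local Notation S := (irwin_hall_rv R M).

Let S2 v : P.-integrable setT (EFin \o (fun s => (tuple_sum s + v) ^+ 2)).
Proof.
apply/integrableP; split.
  by apply/measurable_EFinP; apply: measurable_funX; apply: measurable_funD.
under eq_integral => s _ do rewrite /= ger0_norm ?sqr_ge0//.
by rewrite integral_irwin_hall_sqr ltry.
Qed.

Lemma expectation_irwin_hall : ('E_P[S] = (M%:R / 2)%:E)%E.
Proof.
rewrite unlock.
have E s : S s = 2^-1 * ((tuple_sum s + 1) ^+ 2 - ((tuple_sum s + 0) ^+ 2 + 1)).
  by rewrite /=; field.
under eq_integral do rewrite E.
have i2 : P.-integrable setT (EFin \o (fun s => (tuple_sum s + 0) ^+ 2 + 1)).
  by apply: integrable_addr; [exact: S2|exact: finite_measure_integrable_cst].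
rewrite -[LHS]fineK; last first.
  by apply: integrable_fin_num => //; apply: integrable_mulrl; apply: integrable_subr.
congr (_%:E); rewrite -/(Rintegral P setT _) RintegralZl//; last exact: integrable_subr.
rewrite RintegralB// RintegralD//; last exact: finite_measure_integrable_cst.
rewrite Rintegral_cst//; have -> : fine (P [set: _]) = 1 by rewrite probability_setT.
by rewrite /Rintegral !integral_irwin_hall_sqr/=; field.
Qed.

Lemma variance_irwin_hall : ('V_P[S] = (M%:R / 12)%:E)%E.
Proof.
rewrite /variance unlock expectation_irwin_hall unlock.
transitivity (\int[P]_s ((tuple_sum s + - (M%:R / 2)) ^+ 2)%:E)%E; first by [].
by rewrite integral_irwin_hall_sqr; congr (_%:E); ring.
Qed.

Lemma expectation_cos_irwin_hall (t u : R) :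
  \int[P]_s cos (t * standardize S s + u) =
  sinc (t / (2 * Num.sqrt (M%:R / 12))) ^+ M * cos u.
Proof.
set sd := Num.sqrt _; pose t' := t / sd; pose u' := u - t' * (M%:R / 2).
have -> : \int[P]_s cos (t * standardize S s + u) = \int[P]_s cos (t' * tuple_sum s + u').
  apply: eq_Rintegral => s _; rewrite /standardize/= /standardize_fun.
  by rewrite expectation_irwin_hall variance_irwin_hall/= -/sd /u' /t'; congr cos; ring.
have ic : P.-integrable setT (EFin \o (fun s => cos (t' * tuple_sum s + u'))).
  apply: (@bounded_RV_integrable _ _ _ _ S (fun y => cos (t' * y + u')) 1).
    exact: measurable_cos_affine.
  by move=> y; exact: cos_max.
have := congr1 fine (integral_irwin_hall_cos t' M u'); rewrite -/(Rintegral P setT _).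
rewrite RintegralD//; last exact: finite_measure_integrable_cst.
rewrite Rintegral_cst//; have -> : fine (P [set: _]) = 1 by rewrite probability_setT.
rewrite /= mulr1 => /addrI ->; congr (sinc _ ^+ _ * cos _).
  by rewrite /t' invfM; ring.
by rewrite /u' -[X in X + _]mulr_natr; ring.
Qed.

End irwin_hall_law.

(** * Invariance of the law of the size under permutations of the sides *)

Section symmetry.
Variable R : realType.

Lemma sum_PP_coef a b c (f : nat -> R) n :
  (forall p, p \in PP a b c -> (#|` p| < n)%N) ->
  \sum_(p <- PP a b c) f #|` p| = \sum_(k < n) (pp_gf R a b c)`_k * f k.
Proof.
move=> hn; under [RHS]eq_bigr do rewrite /pp_gf coef_sum mulr_suml.
rewrite exchange_big/=; apply: eq_big_seq => p /hn pn.
rewrite (bigD1 (Ordinal pn))//= coefXn eqxx mul1r big1 ?addr0// => k kp.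
by rewrite coefXn (_ : (k == _ :> nat) = false) ?mul0r//; apply: contra_neqF kp => /eqP kp; exact: val_inj.
Qed.

(** The coefficients of the generating polynomial count the partitions of each size, and these
    counts determine the sum of any function of the size. *)
Lemma sum_PP_gf a b c a' b' c' : pp_gf R a b c = pp_gf R a' b' c' ->
  forall f : nat -> R, \sum_(p <- PP a b c) f #|` p| = \sum_(p <- PP a' b' c') f #|` p|.
Proof.
move=> e f; pose n a b c := \max_(p <- PP a b c) #|` p|.
pose N := (maxn (n a b c) (n a' b' c')).+1.
have h a1 b1 c1 : (n a1 b1 c1 < N)%N -> forall p, p \in PP a1 b1 c1 -> (#|` p| < N)%N.
  by move=> h p pP; apply: leq_ltn_trans h; rewrite /n (big_rem p)//= leq_maxl.
rewrite (@sum_PP_coef _ _ _ _ N) ?(@sum_PP_coef a' b' c' _ N) ?e//; apply: h.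
  by rewrite ltnS leq_maxr.
by rewrite ltnS leq_maxl.
Qed.

Definition cos_size a b c (t u : R) : R :=
  \int[uniform_PP a b c]_p cos (t * standardize (@size_rv R a b c) p + u).

Lemma cos_size_gf a b c a' b' c' t u :
  (0 < a)%N -> (0 < b)%N -> (0 < a')%N -> (0 < b')%N ->
  pp_gf R a b c = pp_gf R a' b' c' -> pp_mu R a b c = pp_mu R a' b' c' ->
  pp_var R a b c = pp_var R a' b' c' -> cos_size a b c t u = cos_size a' b' c' t u.
Proof.
move=> a0 b0 a0' b0' e em ev; rewrite /cos_size !Rintegral_uniform_PP -!mulr_suml.
have -> : #|` PP a b c|%:R = #|` PP a' b' c'|%:R :> R by rewrite -!pp_gf1 e.
congr (_ / _).
under eq_bigr do rewrite standardize_sizeE//.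
under [RHS]eq_bigr do rewrite standardize_sizeE//.
by rewrite em ev; exact: (sum_PP_gf e (fun k => cos (t * ((k%:R - _) / _) + u))).
Qed.

Lemma cos_sizeC a b c t u : (0 < a)%N -> (0 < b)%N ->
  cos_size a b c t u = cos_size b a c t u.
Proof.
move=> a0 b0; apply: cos_size_gf => //; first exact: pp_gfC.
- by rewrite /pp_mu (mulnC a b).
- by rewrite /pp_var (mulnC a b) (addnC a b).
Qed.

Lemma cos_sizeAC a b c t u : (0 < a)%N -> (0 < b)%N -> (0 < c)%N ->
  cos_size a b c t u = cos_size a c b t u.
Proof.
move=> a0 b0 c0; apply: cos_size_gf => //; first exact: pp_gfAC.
- by rewrite /pp_mu (mulnAC a b c).
- by rewrite /pp_var (mulnAC a b c) (addnAC a b c).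
Qed.

Lemma norm_cos_size_le1 a b c t u : `|cos_size a b c t u| <= 1.
Proof.
have ic := bounded_RV_integrable (standardize (@size_rv R a b c))
  (measurable_cos_affine t u) (fun y => cos_max (t * y + u)).
apply: le_trans (le_normr_Rintegral measurableT ic) _.
have -> : 1 = \int[@uniform_PP R a b c]_p 1.
  rewrite Rintegral_cst//.
  by have -> : fine (@uniform_PP R a b c [set: cubes]) = 1; [rewrite probability_setT|rewrite mulr1].
apply: le_Rintegral => //; last by move=> p _; exact: cos_max.
- exact: integrable_norm.
- exact: finite_measure_integrable_cst.
Qed.

End symmetry.

(** * Quantitative normal approximation *)

Section median.

Lemma median3E a b c : median3 a b c = maxn (minn a b) (minn (maxn a b) c).
Proof.
rewrite /median3 /sort/=.
by case: (leqP a b) => ab /=; case: leqP => h1 /=; try case: leqP => h2 /=; lia.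
Qed.

End median.

Section normal_limit.
Variable R : realType.

(** The factors are exchanged one at a time, while all the others have modulus at most 1. *)
Lemma norm_prod_sub (I : finType) (x y : I -> R) :
  (forall i, `|x i| <= 1) -> (forall i, `|y i| <= 1) ->
  `|\prod_i x i - \prod_i y i| <= \sum_i `|x i - y i|.
Proof.
move=> x1 y1.
suff [_ _ //] : [/\ `|\prod_i x i| <= 1, `|\prod_i y i| <= 1 &
    `|\prod_i x i - \prod_i y i| <= \sum_i `|x i - y i|].
elim: (index_enum I) => [|i s [hx hy IH]].
  by rewrite !big_nil subrr normr0 normr1.
rewrite !big_cons !normrM; split.
- by rewrite mulr_ile1.
- by rewrite mulr_ile1.
have -> : x i * \prod_(j <- s) x j - y i * \prod_(j <- s) y j =
  (x i - y i) * \prod_(j <- s) x j + y i * (\prod_(j <- s) x j - \prod_(j <- s) y j) by ring.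
apply: le_trans (ler_normD _ _) _; rewrite !normrM; apply: lerD.
  by rewrite ler_piMr.
by apply: le_trans IH; rewrite ler_piMl.
Qed.

Section largest.
Variables (a b c : nat).
Hypotheses (a0 : (0 < a)%N) (b0 : (0 < b)%N) (ac : (a <= c)%N) (bc : (b <= c)%N).
Variables t u : R.

Let c0 : (0 < c)%N. Proof. exact: leq_trans ac. Qed.
Let s := t / (2 * Num.sqrt (pp_var R a b c)).
Let A : R := a%:R.
Let B : R := b%:R.
Let C : R := c%:R.
Let L : R := A + B + C.

Let A1 : 1 <= A. Proof. by rewrite ler1n. Qed.
Let B1 : 1 <= B. Proof. by rewrite ler1n. Qed.
Let C1 : 1 <= C. Proof. by rewrite ler1n. Qed.
Let AC : A <= C. Proof. by rewrite ler_nat. Qed.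
Let BC : B <= C. Proof. by rewrite ler_nat. Qed.

Let Anz : A != 0. Proof. by rewrite gt_eqF//; apply: lt_le_trans A1. Qed.
Let Bnz : B != 0. Proof. by rewrite gt_eqF//; apply: lt_le_trans B1. Qed.
Let Cnz : C != 0. Proof. by rewrite gt_eqF//; apply: lt_le_trans C1. Qed.
Let Lnz : L != 0. Proof. by rewrite gt_eqF// /L !addr_gt0 ?ltr0n. Qed.

Let s2 : s ^+ 2 = 3 * t ^+ 2 / (A * B * C * L).
Proof.
have v0 := pp_var_gt0 R a0 b0 c0.
rewrite /s exprMn exprVn exprMn sqr_sqrtr ?ltW// /pp_var !natrM !natrD -/A -/B -/C -/L.
by field; rewrite ?Anz ?Bnz ?Cnz ?Lnz.
Qed.

(** As [c] is the largest side, L <= 3c, so (L s)^2 = 3 t^2 L / (abc) <= 9 t^2 / (ab). Summing this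
    fourth-order error over ab cells will leave 1/(ab). *)
Let Ls : (L * s) ^+ 4 <= 81 * t ^+ 4 / (A * B) ^+ 2.
Proof.
have -> : (L * s) ^+ 4 = (L ^+ 2 * s ^+ 2) ^+ 2 by ring.
have -> : 81 * t ^+ 4 / (A * B) ^+ 2 = (9 * t ^+ 2 / (A * B)) ^+ 2 by field; rewrite ?Anz ?Bnz ?Cnz ?Lnz.
apply: lerXn2r; rewrite ?nnegrE.
- by rewrite mulr_ge0 ?sqr_ge0.
- by apply: divr_ge0; apply: mulr_ge0; [|exact: sqr_ge0|exact: ler0n..].
rewrite s2.
have -> : L ^+ 2 * (3 * t ^+ 2 / (A * B * C * L)) = (3 * L / C) * t ^+ 2 / (A * B).
  by field; rewrite ?Anz ?Bnz ?Cnz ?Lnz.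
have AB0 : 0 <= (A * B)^-1 by rewrite invr_ge0; apply: mulr_ge0; exact: ler0n.
rewrite ler_wpM2r//.
rewrite ler_wpM2r ?sqr_ge0// ler_pdivrMr; last by apply: lt_le_trans C1.
by move: AC BC A1 B1; rewrite /L => *; lra.
Qed.

Let dist_prod (m : 'I_a * 'I_b -> R) : (forall l, 0 <= m l <= L) ->
  `|\prod_l sinc (m l * s) - \prod_l expR (- ((m l * s) ^+ 2 / 6))| <= 81 * t ^+ 4 / (A * B).
Proof.
move=> mL; apply: le_trans (norm_prod_sub _ _) _.
- by move=> l; exact: norm_sinc_le1.
- move=> l; rewrite ger0_norm ?expR_ge0// -expR0 ler_expR oppr_le0.
  by rewrite divr_ge0 ?sqr_ge0.
apply: (@le_trans _ _ (\sum_(l : 'I_a * 'I_b) 81 * t ^+ 4 / (A * B) ^+ 2)).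
  apply: ler_sum => l _; apply: le_trans (sinc_expR _) (le_trans _ Ls).
  have e4 (y z : R) : (y * z) ^+ 4 = y ^+ 4 * z ^+ 4 by ring.
  have /andP[m0 m1] := mL l; rewrite (e4 (m l) s) (e4 L s) ler_wpM2r//.
    exact: exprn_even_ge0.
  by apply: lerXn2r; rewrite ?nnegrE// (le_trans m0).
rewrite sumr_const card_prod !card_ord -[leLHS]mulr_natr natrM -/A -/B.
by rewrite le_eqVlt; apply/orP; left; apply/eqP; field; rewrite ?Anz ?Bnz ?Cnz ?Lnz.
Qed.

(** [D0] and [M0] are the Gaussian versions of the denominator [D] and the numerator [M].
    Multiplying by [D0] turns the error into two differences of products, hence 162 = 2 * 81, and
    avoids dividing by [D]. The bound exp(-2 t^2) <= D0 uses l.1 + l.2 + 1 <= 2c. *)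
Lemma cos_size_normal_largest :
  `|cos_size a b c t u - cos u * expR (- 2^-1 * t ^+ 2)| <=
  expR (2 * t ^+ 2) * (162 * t ^+ 4) / (a * b)%:R.
Proof.
have e := expectation_cos_size a0 b0 c0 t u; rewrite -/(cos_size a b c t u) -/s in e.
set D := \prod_(l : 'I_a * 'I_b) sinc _ in e.
set M := \prod_(l : 'I_a * 'I_b) sinc ((c + l.1 + l.2).+1%:R * s) in e.
pose D0 := \prod_(l : 'I_a * 'I_b) expR (- (((l.1 + l.2).+1%:R * s) ^+ 2 / 6)).
pose M0 := \prod_(l : 'I_a * 'I_b) expR (- (((c + l.1 + l.2).+1%:R * s) ^+ 2 / 6)).
have LE : L = (a + b + c)%:R by rewrite !natrD.
have hD : `|D - D0| <= 81 * t ^+ 4 / (A * B).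
  apply: (@dist_prod (fun l => (l.1 + l.2).+1%:R)) => l; rewrite ler0n LE ler_nat.
  by have := ltn_ord l.1; have := ltn_ord l.2; lia.
have hM : `|M - M0| <= 81 * t ^+ 4 / (A * B).
  apply: (@dist_prod (fun l => (c + l.1 + l.2).+1%:R)) => l; rewrite ler0n LE ler_nat.
  by have := ltn_ord l.1; have := ltn_ord l.2; lia.
have MD : M0 = D0 * expR (- 2^-1 * t ^+ 2).
  rewrite /M0 /D0 -!expR_sum -expRD; congr expR.
  rewrite -[LHS](subrK (\sum_(l : 'I_a * 'I_b) - (((l.1 + l.2).+1%:R * s) ^+ 2 / 6))).
  rewrite addrC; congr (_ + _); rewrite -sumrB.
  rewrite (eq_bigr (fun l : 'I_a * 'I_b => ((c + l.1 + l.2).+1%:R ^+ 2 - (l.1 + l.2).+1%:R ^+ 2) * (- s ^+ 2 / 6))); last first.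
    by move=> l _; field.
  rewrite -mulr_suml sum_box_sqr s2 !natrM !natrD -/A -/B -/C -/L.
  by field; rewrite ?Anz ?Bnz ?Cnz ?Lnz.
have D0ge : expR (- (2 * t ^+ 2)) <= D0.
  rewrite /D0 -expR_sum ler_expR sumrN lerN2.
  apply: (@le_trans _ _ (\sum_(l : 'I_a * 'I_b) (2 * C) ^+ 2 * s ^+ 2 / 6)).
    have e2 (y : R) : (y * s) ^+ 2 = y ^+ 2 * s ^+ 2 by ring.
    apply: ler_sum => l _; rewrite e2 ler_wpM2r// ler_wpM2r ?sqr_ge0//.
    apply: lerXn2r; rewrite ?nnegrE ?ler0n ?mulr_ge0 ?ler0n//.
    rewrite /C -natrM ler_nat.
    have lt2 (i : 'I_a) (j : 'I_b) : (i + j < 2 * c)%N.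
      by have := ltn_ord i; have := ltn_ord j; have := ac; have := bc; lia.
    exact: lt2.
  rewrite sumr_const card_prod !card_ord -[leLHS]mulr_natr natrM -/A -/B s2.
  have -> : (2 * C) ^+ 2 * (3 * t ^+ 2 / (A * B * C * L)) / 6 * (A * B) = (2 * C / L) * t ^+ 2.
    by field; rewrite ?Anz ?Bnz ?Cnz ?Lnz.
  rewrite ler_wpM2r ?sqr_ge0// ler_pdivrMr; last by rewrite lt0r Lnz LE ler0n.
  by move: AC BC A1 B1; rewrite /L => *; lra.
have E0 : 0 < expR (- (2 * t ^+ 2)) := expR_gt0 _.
have D00 : 0 < D0 by apply: lt_le_trans D0ge.
set I := cos_size a b c t u in e *.
have key : `|I - cos u * expR (- 2^-1 * t ^+ 2)| * D0 <= 162 * t ^+ 4 / (A * B).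
  rewrite -[X in _ * X](gtr0_norm D00) -normrM.
  have -> : (I - cos u * expR (- 2^-1 * t ^+ 2)) * D0 = I * (D0 - D) + cos u * (M - M0).
    by rewrite MD !mulrBr e; ring.
  apply: le_trans (ler_normD _ _) _; rewrite !normrM.
  have -> : 162 * t ^+ 4 / (A * B) = 1 * (81 * t ^+ 4 / (A * B)) + 1 * (81 * t ^+ 4 / (A * B)) by field; rewrite ?Anz ?Bnz ?Cnz ?Lnz.
  apply: lerD; apply: ler_pM => //; first exact: norm_cos_size_le1.
    by rewrite distrC.
  exact: cos_max.
rewrite natrM -/A -/B -mulrA -[leRHS]mulrC -ler_pdivrMr ?expR_gt0// -expRN.
by apply: le_trans key; rewrite ler_wpM2l.
Qed.

End largest.

(** After a permutation the largest side comes last; the product of the other two is at least the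
    larger of them, which is the median. *)
Lemma cos_size_normal a b c (t u : R) : (0 < a)%N -> (0 < b)%N -> (0 < c)%N ->
  `|cos_size a b c t u - cos u * expR (- 2^-1 * t ^+ 2)| <=
  expR (2 * t ^+ 2) * (162 * t ^+ 4) / (median3 a b c)%:R.
Proof.
move=> a0 b0 c0.
have mono x y : (0 < x)%N -> (x <= y)%N ->
    expR (2 * t ^+ 2) * (162 * t ^+ 4) / y%:R <= expR (2 * t ^+ 2) * (162 * t ^+ 4) / x%:R.
  move=> x0 xy; rewrite ler_wpM2l//.
    by rewrite mulr_ge0 ?expR_ge0// mulr_ge0// exprn_even_ge0.
  by rewrite lef_pV2 ?posrE ?ltr0n ?ler_nat//; exact: leq_trans xy.
have m0 : (0 < median3 a b c)%N by rewrite median3E; lia.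
have [/andP[ac bc]|/nandP h] := boolP ((a <= c) && (b <= c))%N.
  apply: le_trans (cos_size_normal_largest a0 b0 ac bc t u) (mono _ _ m0 _).
  by rewrite median3E; nia.
have [/andP[ab cb]|/nandP h'] := boolP ((a <= b) && (c <= b))%N.
  rewrite cos_sizeAC//.
  apply: le_trans (cos_size_normal_largest a0 c0 ab cb t u) (mono _ _ m0 _).
  by rewrite median3E; nia.
have ba : (b <= a)%N by lia.
have ca : (c <= a)%N by lia.
rewrite cos_sizeC// cos_sizeAC//.
apply: le_trans (cos_size_normal_largest b0 c0 ba ca t u) (mono _ _ m0 _).
by rewrite median3E; nia.
Qed.

End normal_limit.

Lemma cvg_bigprod (R : realType) (I : finType) (f : I -> nat -> R) (l : I -> R) :
  (forall i, f i k @[k --> \oo] --> l i) ->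
  (\prod_i f i k) @[k --> \oo] --> \prod_i l i.
Proof.
move=> fl; elim: (index_enum I) => [|i s IH].
  by under eq_cvg do rewrite big_nil; rewrite big_nil; exact: cvg_cst.
under eq_cvg do rewrite big_cons.
by rewrite big_cons; apply: cvgM.
Qed.

(** * The two limit theorems *)

Section limits.
Variables (R : realType) (a b c : nat -> nat).
Hypotheses (a_gt0 : forall N, (0 < a N)%N) (b_gt0 : forall N, (0 < b N)%N)
  (c_gt0 : forall N, (0 < c N)%N).
Local Notation Xs N := (standardize (@size_rv R (a N) (b N) (c N))).

Let tight (e : R) : 0 < e -> exists A : R, forall N,
  (@uniform_PP R (a N) (b N) (c N) [set p | A < `|Xs N p| ]%R <= e%:E)%E.
Proof.
move=> e0; pose A : R := Num.sqrt (e^-1).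
have A0 : 0 < A by rewrite sqrtr_gt0 invr_gt0.
exists A => N; apply: le_trans (standardize_size_tight (a_gt0 N) (b_gt0 N) (c_gt0 N) A0) _.
by rewrite /A sqr_sqrtr ?invrK// invr_ge0 ltW.
Qed.

Lemma cvg_median_normal : median3 (a N) (b N) (c N) @[N --> \oo] --> \oo ->
  cvg_in_distribution (fun N => Xs N) (std_normal_rv R).
Proof.
move=> med; apply: cvg_cos_in_distribution; last exact: tight.
move=> t u; rewrite [X in _ --> X](normal_cosE t u).
apply/cvgrPdist_le => e e0.
pose K : R := expR (2 * t ^+ 2) * (162 * t ^+ 4).
have K0 : 0 <= K by rewrite /K mulr_ge0 ?expR_ge0// mulr_ge0// exprn_even_ge0.
have [n Kn] : exists n : nat, K / e <= n%:R.
  exists (Num.bound (K / e)); apply/ltW/archi_boundP.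
  exact: divr_ge0 K0 (ltW e0).
move/cvgnyPge : med => /(_ n.+1); apply: filterS => N /= nN.
rewrite distrC; apply: le_trans (cos_size_normal t u (a_gt0 N) (b_gt0 N) (c_gt0 N)) _.
rewrite ler_pdivrMr ?ltr0n; last exact: leq_ltn_trans nN.
rewrite -/K [leRHS]mulrC -ler_pdivrMr//; apply: (le_trans Kn).
by rewrite ler_nat ltnW.
Qed.

Lemma normal_cvg_median : cvg_in_distribution (fun N => Xs N) (std_normal_rv R) ->
  median3 (a N) (b N) (c N) @[N --> \oo] --> \oo.
Proof.
move=> cv; apply/cvgnyPge => K.
(* A point strictly below -2K, where the cdf of the standardized size vanishes as soon as the median
   is less than K. *)
pose x : R := - (2 * K%:R) - 1.
have := cv x (@continuous_cdf_std_normal R x).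
have F0 : (0 < fine (cdf (std_normal_rv R) x)).
  by rewrite -lte_fin fineK ?fin_num_measure// cdf_std_normal_gt0.
rewrite -[cdf (std_normal_rv R) x]fineK ?fin_num_measure// => /fine_cvgP[_].
move=> /cvgrPdist_lt/(_ _ F0); apply: filterS => N hN.
rewrite leqNgt; apply/negP => mK.
have : cdf (Xs N) x = 0%E.
  rewrite /cdf /distribution /pushforward/=.
  rewrite [X in uniform_PP _ _ _ X](_ : _ = set0) ?measure0//.
  apply/seteqP; split => // p /=; rewrite in_itv/=; apply/negP; rewrite -ltNge.
  rewrite standardize_sizeE//.
  have v0 := pp_var_gt0 R (a_gt0 N) (b_gt0 N) (c_gt0 N).
  have s0 : 0 < Num.sqrt (pp_var R (a N) (b N) (c N)) by rewrite sqrtr_gt0.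
  rewrite ltr_pdivlMr//; set sd := Num.sqrt _ in s0 *.
  have sd2 : sd ^+ 2 = pp_var R (a N) (b N) (c N) by rewrite sqr_sqrtr// ltW.
  have mu0 : 0 <= pp_mu R (a N) (b N) (c N) by rewrite divr_ge0 ?ler0n.
  (* Two of the sides are at most K, and the third is at most the sum of all. *)
  have h : (a N * b N * c N <= K * K * (a N + b N + c N))%N.
    have := mK; rewrite median3E; move: (a N) (b N) (c N) => i j k h.
    have [ij|ij] : ((i <= K) && (j <= K) \/ ((i <= K) && (k <= K) \/ (j <= K) && (k <= K)))%N by lia.
      by have := leq_mul (leq_mul (proj1 (andP ij)) (proj2 (andP ij))) (leqnn k); nia.
    by case: ij => /andP[h1 h2]; have := leq_mul h1 h2; nia.
  (* The squared ratio of mean to standard deviation is 3abc/(a+b+c), which is at most 3K^2. *)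
  have mule : pp_mu R (a N) (b N) (c N) <= 2 * K%:R * sd.
    rewrite -(@ler_pXn2r _ 2) ?nnegrE// ?mulr_ge0 ?ler0n ?(ltW s0)//.
    have -> : (2 * K%:R * sd) ^+ 2 = (2 * K%:R) ^+ 2 * pp_var R (a N) (b N) (c N).
      by rewrite -sd2 [LHS]exprMn.
    rewrite /pp_mu /pp_var; move: h; rewrite -(ler_nat R) !natrM.
    set z := (a N)%:R * (b N)%:R * (c N)%:R; set L := (_ + _ + _)%:R => h.
    have z0 : 0 <= z by rewrite !mulr_ge0 ?ler0n.
    have := ler_wpM2l z0 h; move: {h} (K%:R : R) => k h.
    have zz0 : 0 <= z * z by rewrite mulr_ge0.
    rewrite (_ : (2 * k) ^+ 2 * (z * L / 12) = z * (k * k * L) / 3); last by field.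
    by rewrite (_ : (z / 2) ^+ 2 = z * z / 4); [lra|field].
  have p0 : 0 <= #|` p|%:R :> R by rewrite ler0n.
  by rewrite /x mulrBl mulNr mul1r; lra.
move=> e0.
have : `|fine (cdf (std_normal_rv R) x) - fine (cdf (Xs N) x)|
  < fine (cdf (std_normal_rv R) x) := hN.
by rewrite e0 subr0 gtr0_norm// ltxx.
Qed.

(** Integers converging to [M] are eventually equal to it, but [a N] and [b N] may keep changing
    among the factorizations of [M]. These are finitely many, so the limit is taken for fixed sides
    and then made uniform over all of them. *)
Lemma cvg_irwin_hall (M : nat) :
  ((a N * b N)%N%:R : R) @[N --> \oo] --> (M%:R : R) ->
  c N @[N --> \oo] --> \oo ->
  cvg_in_distribution (fun N => Xs N) (standardize (irwin_hall_rv R M)).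
Proof.
move=> abM cy.
have abE : \forall N \near \oo, (a N * b N)%N = M.
  move/cvgrPdist_lt : abM => /(_ 1 ltr01); apply: filterS => N.
  rewrite -[X in X < _]/(`|M%:R - (a N * b N)%:R|) => h.
  have : `|(M%:Z - (a N * b N)%N%:Z)%:~R : R| < 1%:~R.
    by rewrite intrB.
  by rewrite -intr_norm ltr_int; lia.
have M0 : (0 < M)%N.
  have [N _ /(_ N (leqnn N)) <-] := abE.
  by rewrite muln_gt0 a_gt0 b_gt0.
apply: cvg_cos_in_distribution; last exact: tight.
move=> t u; rewrite expectation_cos_irwin_hall.
set tau := t / (2 * Num.sqrt (M%:R / 12)).
have fixed i j : (i * j)%N = M -> cos_size i j k.+1 t u @[k --> \oo] --> sinc tau ^+ M * cos u.
  move=> ijM; have := M0; rewrite -{1}ijM muln_gt0 => /andP[i0 j0].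
  pose s k := t / (2 * Num.sqrt (pp_var R i j k.+1)).
  have ks : k.+1%:R * s k @[k --> \oo] --> tau.
    (* For c = k + 1 the variance is (k+1)^2 (M/12) w(k), so (k+1) s(k) tends to [tau]. *)
    pose w (k : nat) : R := 1 + (i%:R + j%:R) * harmonic k.
    have w1 : w k @[k --> \oo] --> (1 : R).
      rewrite -[X in _ --> X]addr0 -[X in _ --> _ + X](mulr0 (i%:R + j%:R)).
      by apply: cvgD; [exact: cvg_cst|apply: cvgMr; exact: cvg_harmonic].
    have w0 k : 0 < w k by rewrite ltr_pwDl// mulr_ge0 ?addr_ge0// invr_ge0.
    have m0 : 0 < M%:R / 12 :> R by rewrite divr_gt0 ?ltr0n.
    have gen (K q r : R) : K != 0 -> q != 0 -> r != 0 ->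
        K * (t / (2 * (K * (q * r)))) = t / (2 * q) / r.
      by move=> K0 q0 r0; field; rewrite K0 q0 r0.
    have gen2 (I J K : R) : K != 0 ->
        I * J * K * (I + J + K) / 12 = K ^+ 2 * (I * J / 12 * (1 + (I + J) * K^-1)).
      by move=> K0; field.
    have E k : k.+1%:R * s k = tau * (Num.sqrt (w k))^-1.
      have k0 : 0 < k.+1%:R :> R by rewrite ltr0n.
      have -> : s k = t / (2 * (k.+1%:R * (Num.sqrt (M%:R / 12) * Num.sqrt (w k)))).
        rewrite /s (_ : pp_var R i j k.+1 = k.+1%:R ^+ 2 * (M%:R / 12 * w k)).
          by rewrite sqrtrM ?sqr_ge0// sqrtr_sqr (gtr0_norm k0) sqrtrM ?(ltW m0).
        by rewrite /pp_var -ijM !natrM !natrD gen2 ?gt_eqF.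
      by apply: gen; rewrite gt_eqF// sqrtr_gt0.
    rewrite (_ : (fun k => _) = (fun k => tau * (Num.sqrt (w k))^-1)); last exact/funext.
    rewrite -[X in _ --> X]mulr1; apply: cvgMr.
    rewrite -[X in _ --> X]invr1; apply: cvgV; first exact: oner_neq0.
    by rewrite -[X in _ --> X]sqrtr1; apply: cvg_comp w1 _; exact: sqrt_continuous.
  have s0 : s k @[k --> \oo] --> (0 : R).
    rewrite -[X in _ --> X](mulr0 tau).
    have -> : s = (fun k => (k.+1%:R * s k) * harmonic k).
      by apply/funext => k; rewrite mulrAC /harmonic/= divff ?mul1r// pnatr_eq0.
    by apply: cvgM ks _; exact: cvg_harmonic.
  have ns0 n : n%:R * s k @[k --> \oo] --> (0 : R).
    by rewrite -[X in _ --> X](mulr0 n%:R); apply: cvgMr.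
  have ns n : sinc (n%:R * s k) @[k --> \oo] --> (1 : R).
    rewrite -[X in _ --> X](_ : sinc (0 : R) = 1); last by rewrite /sinc eqxx.
    by apply: (@cvg_comp _ _ _ (fun k => n%:R * s k) (@sinc R)) (ns0 n) _; exact: continuous_sinc.
  have ms0 n m : (k.+1 + n + m).+1%:R * s k @[k --> \oo] --> tau.
    rewrite (_ : (fun k => _) = (fun k => k.+1%:R * s k + (n + m).+1%:R * s k)); last first.
      by apply/funext => k; rewrite -addnA -addnS natrD mulrDl.
    by rewrite -[X in _ --> X]addr0; apply: cvgD ks (ns0 _).
  have ms n m : sinc ((k.+1 + n + m).+1%:R * s k) @[k --> \oo] --> sinc tau.
    apply: (@cvg_comp _ _ _ (fun k => (k.+1 + n + m).+1%:R * s k) (@sinc R)) (ms0 n m) _.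
    exact: continuous_sinc.
  pose D k := \prod_(l : 'I_i * 'I_j) sinc ((l.1 + l.2).+1%:R * s k).
  pose Mk k := \prod_(l : 'I_i * 'I_j) sinc ((k.+1 + l.1 + l.2).+1%:R * s k).
  have cD : D k @[k --> \oo] --> (1 : R).
    rewrite -[X in _ --> X](_ : \prod_(l : 'I_i * 'I_j) (1 : R) = 1); last exact: big1.
    by apply: cvg_bigprod => l; exact: ns.
  have cM : Mk k @[k --> \oo] --> sinc tau ^+ M.
    rewrite -[X in _ --> X](_ : \prod_(l : 'I_i * 'I_j) sinc tau = _); last first.
      by rewrite prodr_const card_prod !card_ord ijM.
    by apply: cvg_bigprod => l; exact: ms.
  have Dn0 : \forall k \near \oo, D k != 0 by apply: cvgr_neq0 cD (oner_neq0 _).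
  have e : \forall k \near \oo, Mk k * cos u / D k = cos_size i j k.+1 t u.
    apply: filterS Dn0 => k Dk.
    have H : cos_size i j k.+1 t u * D k = cos u * Mk k.
      exact: (expectation_cos_size i0 j0 (ltn0Sn k)).
    by rewrite (mulrC (Mk k)) -H mulfK.
  have q : Mk k * cos u / D k @[k --> \oo] --> sinc tau ^+ M * cos u / 1.
    apply: cvgM; first by apply: cvgM => //; exact: cvg_cst.
    by apply: cvgV => //; exact: oner_neq0.
  by apply: cvg_trans (near_eq_cvg e) _; move: q; rewrite divr1.
apply/cvgrPdist_le => e e0.
(* Both factors of [M] are at most [M], so the pairs live in a finite type and share one
   threshold. *)
have unif : \forall k \near \oo, forall l : 'I_M.+1 * 'I_M.+1, (l.1 * l.2)%N = M ->
    `|sinc tau ^+ M * cos u - cos_size l.1 l.2 k.+1 t u| <= e.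
  apply: filter_forall => l; have [lM|lM] := eqVneq (l.1 * l.2)%N M; last first.
    by apply: nearW => k /eqP; rewrite (negbTE lM).
  by move/cvgrPdist_le : (fixed _ _ lM) => /(_ _ e0); apply: filterS.
have [K _ KP] := unif.
near=> N.
have abN : (a N * b N)%N = M by near: N.
have cN : (K.+1 <= c N)%N by near: N; move/cvgnyPge : cy; exact.
have aM : (a N < M.+1)%N by rewrite ltnS -abN leq_pmulr.
have bM : (b N < M.+1)%N by rewrite ltnS -abN leq_pmull.
have := KP (c N).-1 _ (Ordinal aM, Ordinal bM) abN.
by rewrite /= prednK//; apply; lia.
Unshelve. all: by end_near. Qed.

End limits.

Unset Implicit Arguments.

Theorem theorem1p11 (R : realType) (a b c : nat -> nat)
    (a_gt0 : forall N, (0 < a N)%N) (b_gt0 : forall N, (0 < b N)%N)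
    (c_gt0 : forall N, (0 < c N)%N) :
  (cvg_in_distribution (fun N => standardize (@size_rv R (a N) (b N) (c N)))
     (std_normal_rv R)
   <-> median3 (a N) (b N) (c N) @[N --> \oo] --> \oo) /\
  (forall M : nat,
     ((a N * b N)%N%:R : R) @[N --> \oo] --> (M%:R : R) ->
     c N @[N --> \oo] --> \oo ->
     cvg_in_distribution (fun N => standardize (@size_rv R (a N) (b N) (c N)))
       (standardize (irwin_hall_rv R M))).
Proof.
split; last by move=> M; exact: cvg_irwin_hall.
by split; [exact: normal_cvg_median|exact: cvg_median_normal].
Qed.
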